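(* Let $k\ge 1$ be an integer and let $G$ be a $k$-connected interval graph. Then a CDS partition of $G$ of size $k$ exists, and it can be computed in polynomial time.
   Context: All graphs are finite, undirected and simple. A graph is $k$-connected if it has more than $k$ vertices and the removal of any vertex set of size at most $k-1$ does not disconnect it. A graph is an interval graph if its vertices can be represented by intervals on the real line so that two distinct vertices are adjacent if and only if their intervals intersect. A connected dominating set (CDS) of $G$ is a nonempty set $S\subseteq V(G)$ such that $G[S]$ is connected and every vertex of $V(G)\setminus S$ is adjacent to some vertex of $S$. A CDS partition of $G$ of size $k$ is a partition of $V(G)$ into $k$ pairwise disjoint sets, each of which is a connected dominating set of $G$. *)

(* Defs.v *)
From HB Require Import structures.
From mathcomp Require Import all_boot all_order all_algebra.
From mathcomp Require Import reals.

Set Implicit Arguments.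
Unset Strict Implicit.
Unset Printing Implicit Defensive.

Record sgraph (V : finType) := SGraph {
  adj :> rel V;
  adj_sym : symmetric adj;
  adj_irrefl : irreflexive adj }.

Section Graphs.
Variables (V : finType) (G : sgraph V).

Definition induced_adj (S : {set V}) : rel V :=
  [rel x y | [&& x \in S, y \in S & G x y]].

(* The empty set counts as connected here; nonemptiness is required separately
   where it matters. *)
Definition induced_connected (S : {set V}) : Prop :=
  {in S &, forall x y, connect (induced_adj S) x y}.

Definition k_connected (k : nat) : Prop :=
  k < #|V| /\ forall X : {set V}, #|X| < k -> induced_connected (~: X).

(* The intervals may be open, closed, half-open or unbounded. *)
Definition interval_graph (R : realType) : Prop :=
  exists I : V -> interval R,
    (forall v, exists x : R, x \in I v) /\
    forall u v, u != v -> (G u v <-> exists x : R, x \in I u /\ x \in I v).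

Definition connected_dominating (S : {set V}) : Prop :=
  [/\ S != set0, induced_connected S
    & forall v, v \notin S -> exists2 u, u \in S & G v u].

Definition cds_partition (k : nat) (P : {set {set V}}) : Prop :=
  [/\ partition P [set: V], #|P| = k
    & forall S, S \in P -> connected_dominating S].

End Graphs.

(* Random-access machine whose cells hold natural numbers, programmed by
   structured while-programs. The arithmetic is addition and truncated
   subtraction only: without unit-cost multiplication, the values computed in
   t steps have O(t) more bits than the input, so that polynomial time on this
   machine is polynomial time on Turing machines. *)
Inductive expr : Type :=
| Const of nat
| Read of expr
| Add of expr & expr
| Sub of expr & expr.

Inductive cmd : Type :=
| Skip
| Store of expr & expr
| Seq of cmd & cmd
| If of expr & cmd & cmd
| While of expr & cmd.

Definition memory := nat -> nat.

Definition update (m : memory) (a x : nat) : memory :=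
  fun b => if b == a then x else m b.

Fixpoint eval (m : memory) (e : expr) : nat :=
  match e with
  | Const x => x
  | Read e1 => m (eval m e1)
  | Add e1 e2 => eval m e1 + eval m e2
  | Sub e1 e2 => eval m e1 - eval m e2
  end.

Fixpoint expr_cost (e : expr) : nat :=
  match e with
  | Const _ => 1
  | Read e1 => (expr_cost e1).+1
  | Add e1 e2 | Sub e1 e2 => (expr_cost e1 + expr_cost e2).+1
  end.

(* [exec c m t m']: started in memory m, the program c halts after t steps in
   memory m'. Tests succeed on nonzero values. *)
Inductive exec : cmd -> memory -> nat -> memory -> Prop :=
| ExecSkip m : exec Skip m 1 m
| ExecStore e1 e2 m :
    exec (Store e1 e2) m (expr_cost e1 + expr_cost e2).+1
      (update m (eval m e1) (eval m e2))
| ExecSeq c1 c2 m t1 m1 t2 m2 :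
    exec c1 m t1 m1 -> exec c2 m1 t2 m2 ->
    exec (Seq c1 c2) m (t1 + t2).+1 m2
| ExecIfTrue e c1 c2 m t m' :
    eval m e != 0 -> exec c1 m t m' ->
    exec (If e c1 c2) m (expr_cost e + t).+1 m'
| ExecIfFalse e c1 c2 m t m' :
    eval m e = 0 -> exec c2 m t m' ->
    exec (If e c1 c2) m (expr_cost e + t).+1 m'
| ExecWhileTrue e c m t1 m1 t2 m2 :
    eval m e != 0 -> exec c m t1 m1 -> exec (While e c) m1 t2 m2 ->
    exec (While e c) m (expr_cost e + t1 + t2).+1 m2
| ExecWhileFalse e c m :
    eval m e = 0 -> exec (While e c) m (expr_cost e).+1 m.

(* Input: n in cell 0, k in cell 1, then the adjacency matrix row by row, and 0
   in all remaining cells. *)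
Definition encode n (G : sgraph 'I_n) (k : nat) : memory := fun a =>
  match a with
  | 0 => n
  | 1 => k
  | b.+2 => [exists i : 'I_n, exists j : 'I_n, (b == n * i + j) && G i j]
  end.

(* Output: cell v holds the index, among 0, ..., k - 1, of the class of the
   vertex v. *)
Definition decode n (k : nat) (m : memory) : {set {set 'I_n}} :=
  [set [set v : 'I_n | m v == i] | i : 'I_k].

(* Main.v *)
(* Fix a vertex a and let A(w) be the component of a in G - N[w] (empty if a is in
   N[w]) and key(w) = |A(w)|. If a has the leftmost right endpoint, then A(.) grows
   with the left endpoint, so the keys sort the vertices by left endpoint, except
   for vertices hidden under others. The useful vertices (those in N[a], or with
   nonadjacent neighbours x, w such that x is in A(w)) include all inner vertices
   of induced paths from a, and satisfy: if u is useful, u ~ y and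
   key u < key w <= key y, then u ~ w.  Conversely, whenever N(a) is a clique and
   this property holds, process the useful vertices by increasing key, putting each
   of them into the class whose reach (largest key adjacent to the class) is
   smallest, and put the other vertices anywhere.  If some class had no vertex u
   with key u < key w <= reach u, then, the reaches of the classes being the k
   largest ones, fewer than k vertices would have this property; but they separate
   a from w. So every class meets the smaller-key neighbours of every w outside
   N[a], which makes it connected and dominating.
   The program tries all vertices a. *)
Require Import Defs.
From mathcomp Require Import all_boot all_order all_algebra.
From mathcomp Require Import reals zify.

Import Order.TTheory.

Set Implicit Arguments.
Unset Strict Implicit.
Unset Printing Implicit Defensive.

(** * Keys and useful vertices *)

Section Balls.
Variables (V : finType) (e : rel V) (a : V).

(** Balls refine [connect] by a distance: they provide the shortest path in [crossing] and the
    round-by-round invariant of the marking loop. *)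
Fixpoint ball (r : nat) : {set V} :=
  if r is r'.+1 then ball r' :|: [set y | [exists x in ball r', e x y]]
  else [set a].

Lemma ball_step r x y : x \in ball r -> e x y -> y \in ball r.+1.
Proof. by move=> xr xy; rewrite !inE; apply/orP; right; apply/exists_inP; exists x. Qed.

Lemma ballS r y :
  y \in ball r.+1 -> y \in ball r \/ exists2 x, x \in ball r & e x y.
Proof. by rewrite /= !inE => /orP[|/exists_inP]; [left | right]. Qed.

Lemma ball_mono r s : r <= s -> ball r \subset ball s.
Proof.
move=> /subnK <-; elim: (s - r) => [|d IHd]; first by rewrite add0n.
by apply: subset_trans IHd _; rewrite addSn /= subsetUl.
Qed.

Lemma ball_connect r x : x \in ball r -> connect e a x.
Proof.
elim: r x => [|r IHr] x; first by rewrite inE => /eqP->; apply: connect0.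
case/ballS => [/IHr // | [y /IHr ay yx]].
exact: connect_trans ay (connect1 yx).
Qed.

(** A path may be taken without repeated vertices, which bounds its length by [#|V|]. *)
Lemma connect_ball x : connect e a x = (x \in ball #|V|).
Proof.
apply/idP/idP => [/connectP[p ep ->] | /ball_connect //].
case/shortenP: ep => q eq_ uq _.
have {uq}sq : size q <= #|V|.
  by rewrite ltnW // -[X in X <= _](card_uniqP uq) max_card.
apply: (subsetP (ball_mono sq)); move: sq => _.
elim/last_ind: q eq_ => [|q y IHq]; first by rewrite inE.
rewrite rcons_path last_rcons size_rcons => /andP[/IHq lq qy].
exact: ball_step lq qy.
Qed.

End Balls.

Section Keys.
Variables (V : finType) (G : sgraph V) (a : V).
Implicit Types u v w x y z : V.

(* For [w] outside the closed neighbourhood of [a], [before w] is the component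
   of [a] in [G - N[w]]; it is empty when [a] lies in [N[w]]. *)
Definition far w : {set V} := [set x | (x != w) && ~~ G w x].

Definition before w : {set V} :=
  [set x | (a \in far w) && connect (induced_adj G (far w)) a x].

Definition key w := #|before w|.

Definition useful u :=
  [|| u == a, G a u
    | [exists w, exists x, [&& x \in before w, G x u & G u w]]].

(** The maximum is the reach of [u]; the successor lets 0 stand for the load of an empty class. *)
Definition load u := (\max_(y | (y == u) || G u y) key y).+1.

Definition simplicial :=
  [forall x, forall y, [&& G a x, G a y & x != y] ==> G x y].

Definition umbrella_free :=
  [forall u, forall w, forall y,
     [&& useful u, G u y, key u < key w & key w <= key y] ==> G u w].

Lemma adjC x y : G x y = G y x. Proof. exact: adj_sym. Qed.

Lemma induced_adj_sym (S : {set V}) : symmetric (induced_adj G S).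
Proof. by move=> x y; rewrite /induced_adj /= adjC andbCA. Qed.

Lemma induced_connect_mem (S : {set V}) x y :
  x \in S -> connect (induced_adj G S) x y -> y \in S.
Proof.
move=> xS; rewrite connect_ball => xy.
have /orP[/eqP-> //|//] : (y == x) || (y \in S).
elim: #|V| y xy => [|r IHr] y; first by rewrite inE => ->.
case/ballS => [/IHr // | [z _ /and3P[_ yS _]]]; by rewrite yS orbT.
Qed.

Lemma beforeE w x : (x \in before w) =
  (a \in far w) && connect (induced_adj G (far w)) a x.
Proof. exact: in_set. Qed.

Lemma before_far w x : x \in before w -> x \in far w.
Proof. by rewrite beforeE => /andP[aw]; apply: induced_connect_mem. Qed.

Lemma before_src w : a \in far w -> a \in before w.
Proof. by move=> aw; rewrite inE aw connect0. Qed.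

Lemma before_step w x y :
  x \in before w -> G x y -> y \in far w -> y \in before w.
Proof.
move=> xw xy yw; have xf := before_far xw.
move: xw; rewrite !beforeE => /andP[-> ax] /=.
by apply: connect_trans ax (connect1 _); apply/and3P.
Qed.

Lemma before_ind w (P : V -> Prop) :
  (a \in far w -> P a) ->
  (forall x y, x \in before w -> P x -> G x y -> y \in far w -> P y) ->
  forall x, x \in before w -> P x.
Proof.
move=> P0 PS x; rewrite beforeE => /andP[aw]; rewrite connect_ball.
elim: #|V| x => [|r IHr] x; first by rewrite inE => /eqP->; apply: P0.
case/ballS => [/IHr // | [y yr /and3P[_ xw yx]]].
apply: PS (IHr _ yr) yx xw.
by rewrite beforeE aw (ball_connect yr).
Qed.

(** If nonempty, [before w] is connected and contains [a]; once it avoids N[w'], it lies within the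
    component of [a] in G - N[w']. *)
Lemma before_sub w w' :
  {subset before w <= far w'} -> before w \subset before w'.
Proof.
move=> ww'; apply/subsetP.
apply: (before_ind (P := fun x => x \in before w')) => [aw|x y xw xw' xy yw].
  by apply/before_src/ww'/before_src.
by apply: (before_step xw' xy); apply/ww'; apply: before_step xw xy yw.
Qed.

Lemma key0P w : (key w == 0) = (w == a) || G a w.
Proof.
rewrite cards_eq0; apply/eqP/idP => [b0|aw].
  apply/negPn/negP; rewrite negb_or => /andP[wa aw].
  have /before_src : a \in far w by rewrite inE eq_sym wa adjC.
  by rewrite b0 inE.
apply/setP=> x; rewrite !inE; case/orP: aw => [/eqP->|aw]; first by rewrite eqxx.
by rewrite (adjC w a) aw andbF.
Qed.

Lemma key_lt w : key w < #|V|.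
Proof.
apply: proper_card; apply/properP; split; first exact/subsetP.
exists w => //; apply/negP => /before_far; by rewrite inE eqxx.
Qed.

Lemma useful0 u : key u = 0 -> useful u.
Proof. by move=> /eqP; rewrite key0P /useful orbA => ->. Qed.

Lemma loadP u t :
  reflect (exists2 y, (y == u) || G u y & t <= key y) (t < load u).
Proof.
rewrite ltnS; apply: (iffP idP) => [tu|[y uy ty]]; last first.
  exact: (bigop.bigmax_sup y).
have [|y uy yE] := eq_bigmax_cond key (A := [pred y | (y == u) || G u y]).
  by apply/card_gt0P; exists u; rewrite inE eqxx.
exists y => //.
apply: leq_trans tu _; apply: eq_leq; rewrite -yE; apply: eq_bigl => z; by rewrite inE.
Qed.

(* Along a shortest path from [a] towards [w] avoiding [S], consider the first
   vertex [y] whose key is at least that of [w]; its predecessor [u] is useful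
   since the part of the path before [u] avoids the neighbours of [y]. *)
Lemma crossing (S : {set V}) w :
  a \in S -> 0 < key w -> connect (induced_adj G S) a w ->
  exists u y, [/\ u \in S, useful u, G u y, key u < key w & key w <= key y].
Proof.
move=> aS w0; rewrite connect_ball; set e := induced_adj G S => aw.
pose hit r := [exists y in ball e a r, key w <= key y].
have hn : exists r, hit r by exists #|V|; apply/exists_inP; exists w.
case: (ex_minnP hn) => -[|r] /exists_inP[y yr wy] rmin.
  move: yr w0 wy; rewrite inE => /eqP->.
  by have /eqP-> : key a == 0 by [rewrite key0P eqxx]; case: (key w).
have low z s : z \in ball e a s -> s <= r -> key z < key w.
  move=> zs sr; rewrite ltnNge; apply/negP => wz.
  have /rmin : hit s by apply/exists_inP; exists z.
  by rewrite ltnNge sr.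
case/ballS: yr => [/low/(_ (leqnn _))|[u ur /and3P[uS yS uy]]].
  by rewrite ltnNge wy.
exists u, y; split=> //; last exact: low ur _.
have yNr : y \notin ball e a r.
  by apply/negP => /low/(_ (leqnn _)); rewrite ltnNge wy.
case: r ur {rmin} low yNr => [|r] ur low yNr.
  by move: ur; rewrite /useful inE => ->.
have SB s z : z \in ball e a s -> z \in S.
  by move/ball_connect; apply: induced_connect_mem.
case/ballS: ur => [ur|[x xr /and3P[xS _ xu]]].
  by case/negP: yNr; apply: ball_step ur _; apply/and3P.
(* If the ball of radius [r] contained [y] or a neighbour of [y], then [y] would lie in the ball of
   radius [r.+1]. *)
have xy s z : s <= r -> z \in ball e a s -> z \in far y.
  move=> sr zs; have zr := subsetP (@ball_mono _ e a _ _ sr) _ zs.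
  rewrite inE; apply/andP; split.
    by apply: contraNneq yNr => <-; rewrite (subsetP (@ball_mono _ e a _ _ (leqnSn r))).
  apply: contra yNr => yz; apply: (ball_step zr).
  by apply/and3P; rewrite adjC; split=> //; apply: SB zr.
apply/or3P/Or33/existsP; exists y; apply/existsP; exists x; rewrite xu uy !andbT.
have aB : a \in before y by apply/before_src/(xy 0); rewrite ?inE.
clear xS xu low yNr; elim: r xy x xr => [|s IHs] xy x.
  by rewrite inE => /eqP->.
case/ballS => [xs|[z zs /and3P[_ xS zx]]].
  by apply: (IHs _ _ xs) => s' z s's; apply: xy; apply: leqW.
apply: (before_step (IHs _ _ zs) zx).
  by move=> s' z' s's; apply: xy; apply: leqW.
by apply: (xy s.+1) => //; apply: (ball_step zs); apply/and3P; split=> //; apply: SB zs.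
Qed.

End Keys.

(** * Interval orders *)

(* [lt u v] stands for: the interval of [u] lies entirely to the left of that of [v]. *)
Section IntervalOrder.
Variables (V : finType) (G : sgraph V) (lt : rel V).
Hypothesis lt_irr : irreflexive lt.
(** The Ferrers condition: two chains of length two are never mutually incomparable, which
    distinguishes interval orders among partial orders. *)
Hypothesis ltF : forall u v w z, lt u v -> lt w z -> lt u z || lt w v.
Hypothesis ltG : forall u v, u != v -> G u v = ~~ (lt u v || lt v u).

Lemma lt_trans_of_Ferrers : transitive lt.
Proof. by move=> v u w uv vw; have := ltF uv vw; rewrite lt_irr orbF. Qed.

Lemma ltNadj u v : lt u v -> ~~ G u v.
Proof.
move=> uv; case: (eqVneq u v) uv => [->|/ltG->]; first by rewrite lt_irr.
by move->.
Qed.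

Lemma ltNadjr u v : lt v u -> ~~ G u v.
Proof. by rewrite adjC; apply: ltNadj. Qed.

Lemma lt_far u v : lt u v -> u \in far G v.
Proof.
move=> uv; rewrite inE ltNadjr // andbT; apply: contraTneq uv => ->.
by rewrite lt_irr.
Qed.

Lemma far_lt u v : u \in far G v -> lt u v || lt v u.
Proof. by rewrite inE => /andP[uv]; rewrite adjC ltG // negbK. Qed.

(** * A vertex with the leftmost right endpoint *)

Section Leftmost.
Variable a : V.
Hypothesis amax : forall u v, lt u v -> lt a v.

Let Nlt_a u : ~~ lt u a.
Proof. by apply/negP => /amax; rewrite lt_irr. Qed.

(** If one of two neighbours of [a] lay to the left of the other, [a] would lie to the left of that
    other one as well. *)
Lemma leftmost_simplicial : simplicial G a.
Proof.
apply/forallP=> x; apply/forallP=> y; apply/implyP=> /and3P[ax ay xy].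
rewrite ltG //; apply/negP => /orP[] /amax /ltNadj; rewrite ?ax ?ay //.
Qed.

(** A walk from [a] avoiding N[w] starts on the left of [w] and cannot jump across: an edge from the
    left to the right of [w] would join comparable vertices. *)
Lemma before_lt w x : x \in before G a w -> lt x w.
Proof.
apply: (before_ind (P := fun x => lt x w)) x => [/far_lt|x y _ xw xy /far_lt].
  by rewrite (negPf (Nlt_a w)) orbF.
case/orP=> // wy; by case/negP: (ltNadj (lt_trans_of_Ferrers xw wy)).
Qed.

(** The main case is a witness [x] in [before w'] with [u] adjacent to both [x] and [w']. Whatever
    is left of [w'] is left of [w], for otherwise the Ferrers condition puts [u] left of its
    neighbour [w']. So [before w'] is contained in [before w], and [u] is reached through [x]. *)
Lemma useful_before u w : useful G a u -> lt u w -> u \in before G a w.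
Proof.
move=> Uu uw; have aw : a \in before G a w by apply/before_src/lt_far/(amax uw).
case/or3P: Uu => [/eqP-> // | au | /existsP[w' /existsP[x /and3P[xw' xu uw']]]].
  exact: before_step aw au (lt_far uw).
apply: before_step (xu) (lt_far uw); apply: subsetP xw'.
apply: before_sub => z /before_lt zw'; apply: lt_far.
have := ltF zw' uw; case/orP=> // /ltNadj; by rewrite uw'.
Qed.

(** For nonadjacent [u] and [w] one of the key inequalities fails: [w] left of [u] gives [before w]
    inside [before u], and [u] left of [w] gives [before y] strictly inside [before w], with [u] in
    the difference. *)
Lemma leftmost_umbrella_free : umbrella_free G a.
Proof.
apply/forallP=> u; apply/forallP=> w; apply/forallP=> y.
apply/implyP=> /and4P[Uu uy kuw kwy].
have uw : u != w by apply: contraTneq kuw => ->; rewrite ltnn.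
rewrite ltG //; apply/negP => /orP[] ltuw; last first.
  move: kuw; rewrite ltnNge => /negP[]; apply/subset_leq_card/before_sub.
  by move=> z /before_lt zw; apply/lt_far/(lt_trans_of_Ferrers zw ltuw).
move: kwy; rewrite leqNgt => /negP[]; apply/proper_card/properP; split.
  apply: before_sub => z /before_lt zy; apply/lt_far.
  have := ltF zy ltuw; case/orP=> // /ltNadj; by rewrite uy.
exists u; first exact: useful_before.
by apply/negP => /before_far; rewrite inE adjC uy andbF.
Qed.

End Leftmost.

(* The successor sets form a chain; a vertex with the most successors has the
   leftmost right endpoint. *)
Lemma leftmost_exists : 0 < #|V| -> exists a, forall u v, lt u v -> lt a v.
Proof.
case/card_gt0P=> a0 _.
pose s u := #|[set v | lt u v]|.
case: (arg_maxnP s (isT : xpredT a0)) => a _ amax; exists a => u v uv.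
apply/negPn/negP => av; have : s u <= s a := amax u isT.
rewrite leqNgt => /negP[]; apply/proper_card/properP; split; last by exists v; rewrite inE.
apply/subsetP=> z; rewrite !inE => az.
by have := ltF az uv; rewrite (negPf av) => /=.
Qed.

End IntervalOrder.

(** * From representing intervals to an interval order *)

Lemma interval_convex (R : realType) (i : interval R) (x y z : R) :
  x \in i -> z \in i -> (x <= y)%O -> (y <= z)%O -> y \in i.
Proof.
case: i => l r; rewrite !itv_boundlr => /andP[lx _] /andP[_ zr] xy yz.
by apply/andP; split; [apply: le_trans lx _ | apply: le_trans zr]; rewrite bnd_simp.
Qed.

(** Endpoints may be infinite or not attained, so the order is read off from one chosen point [p v]
    of each interval; by convexity, disjoint intervals compare like their chosen points. *)
Lemma interval_graph_order (R : realType) (V : finType) (G : sgraph V) :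
  interval_graph G R ->
  exists lt : rel V,
    [/\ irreflexive lt,
        forall u v w z, lt u v -> lt w z -> lt u z || lt w v
      & forall u v, u != v -> G u v = ~~ (lt u v || lt v u)].
Proof.
move=> [I [/fin_all_exists[p pI] GI]].
pose lt u v := [&& u != v, ~~ G u v & (p u < p v)%O].
have ltP u v x y : lt u v -> x \in I u -> y \in I v -> (x < y)%O.
  move=> /and3P[uv /negP NG puv] xu yv; rewrite ltNge; apply/negP => yx.
  apply: NG; apply/(GI _ _ uv); have [yp|py] := leP y (p u).
    exists (p u); split=> //; exact: interval_convex yv (pI v) yp (ltW puv).
  exists y; split=> //; exact: interval_convex (pI u) xu (ltW py) yx.
have NltP u v : ~~ lt u v -> exists x y, [/\ x \in I u, y \in I v & (y <= x)%O].
  rewrite /lt; case: (eqVneq u v) => [->|uv] /=; first by exists (p v), (p v).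
  case: (boolP (G u v)) => [/(GI _ _ uv)[x [xu xv]]|_] /=; first by exists x, x.
  by rewrite -leNgt; exists (p u), (p v).
exists lt; split=> [u|u v w z uv wz|u v uv]; first by rewrite /lt eqxx.
  apply/negPn; rewrite negb_or; apply/negP => /andP[/NltP[x [y [xu yz yx]]]].
  case/NltP=> [x' [y' [xw yv yx']]].
  have xy' := ltP _ _ _ _ uv xu yv; have x'y := ltP _ _ _ _ wz xw yz.
  (* The failure of both alternatives yields the cycle [y <= x < y' <= x' < y]. *)
  have := le_lt_trans yx (lt_le_trans xy' (le_trans yx' (ltW x'y))).
  by rewrite ltxx.
rewrite /lt uv (eq_sym v) uv (adjC G v u); case: (boolP (G u v)) => //= /negP NG.
rewrite negb_or -!leNgt; apply/esym/negbTE/negP => /andP[vu uv'].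
case: NG; apply/(GI _ _ uv); exists (p u); split=> //.
by have /le_anti -> : (p u <= p v <= p u)%O by rewrite uv' vu.
Qed.

Lemma interval_graph_leftmost (R : realType) (V : finType) (G : sgraph V) :
  0 < #|V| -> interval_graph G R ->
  exists a, simplicial G a && umbrella_free G a.
Proof.
move=> V0 /interval_graph_order[lt [irr F GE]].
have [a amax] := leftmost_exists F V0; exists a.
by rewrite (leftmost_simplicial irr GE) // (leftmost_umbrella_free irr F GE).
Qed.

(** * Soundness of the greedy labelling *)

Section GreedySound.
Variables (V : finType) (G : sgraph V) (a : V) (k : nat) (F : V -> nat).
Hypothesis simp : simplicial G a.
Hypothesis umb : umbrella_free G a.
Hypothesis conn : k_connected G k.

Definition light t := [pred u | useful G a u && (key G a u < t)].

(* If class [i] misses all the light vertices of load above [s], then the greedy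
   rule never gave two of them to the same class, so there are fewer than [k]. *)
Definition balanced t := forall s i, i < k ->
  (exists u, [/\ light t u, F u = i & s < load G a u])
  \/ {in [pred u | light t u && (s < load G a u)] &, injective F}.

Hypothesis Fk : forall u, F u < k.
Hypothesis bal : forall t, t <= #|V| -> balanced t.

(** Pigeonhole: if no vertex of the set is labelled [i], the injective labelling maps it into the
    other [k - 1] labels. *)
Lemma balanced_card t s i : t <= #|V| -> i < k ->
  (exists u, [/\ light t u, F u = i & s < load G a u])
  \/ #|[set u | light t u && (s < load G a u)]| < k.
Proof.
move=> tn ik; have [|inj] := bal tn s ik; first by left.
set T := [set u | _]; case: (boolP [exists u in T, F u == i]) => [|/exists_inPn Ni].
  by case/exists_inP=> u; rewrite !inE => /andP[? ?] /eqP ?; left; exists u.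
right; pose f u : 'I_k := Ordinal (Fk u).
have fi : {in T &, injective f}.
  by move=> u v; rewrite !inE => uT vT [uv]; apply: inj uv; rewrite inE.
rewrite -(card_in_imset fi) -[X in _ < X]card_ord; apply: proper_card.
apply/properP; split; first exact/subsetP.
exists (Ordinal ik) => //; apply/negP => /imsetP[u uT [iE]].
by have := Ni u uT; rewrite iE eqxx.
Qed.

Lemma class_meets_source i : i < k -> exists2 u, (u == a) || G a u & F u = i.
Proof.
move=> ik; have [kV kc] := conn.
have n1 : 1 <= #|V| by apply: leq_trans kV.
(* At threshold 1 and [s = 0] the vertices in question are exactly those of N[a], since loads are
   positive. *)
case: (balanced_card 0 n1 ik) => [[u [/andP[_]]]|].
  by rewrite ltnS leqn0 key0P => ua Fu _; exists u.
set T := [set u | _] => Tk; exfalso.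
have TE u : (u \in T) = (u == a) || G a u.
  rewrite -key0P !inE ltnS leqn0 andbT; apply/andb_idl => /eqP.
  exact: useful0.
have [z zT] : exists z, z \notin T.
  apply/existsP; rewrite -negb_forall; apply/negP => /forallP TT.
  have : #|V| <= #|T| by apply/subset_leq_card/subsetP => x _; apply: TT.
  by rewrite leqNgt (ltn_trans Tk).
move: zT; rewrite TE negb_or => /andP[za /negPf az].
(* Deleting N(a), but not [a] itself, leaves [a] isolated, hence cut off from [z]. *)
have /kc c : #|T :\ a| < k by apply: leq_ltn_trans Tk; rewrite subset_leq_card ?subD1set.
have {c} : connect (induced_adj G (~: (T :\ a))) a z.
  by apply: c; rewrite in_setC in_setD1 ?eqxx // za TE (negPf za) az.
case/connectP=> -[|x p] /=; first by move=> _ zE; rewrite zE eqxx in za.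
case/andP=> /and3P[_ + ax]; rewrite in_setC in_setD1 TE ax orbT andbT negbK.
by move=> /eqP xa; rewrite xa adj_irrefl in ax.
Qed.

(** Threshold and [s] are both [key w]. A vertex of the class whose reach crosses this value is
    adjacent to [w] by [umb]. If there is none, fewer than [k] vertices cross it, and k-connectivity
    gives a path from [a] to [w] avoiding them all, which [crossing] forbids. *)
Lemma class_meets_earlier i w :
  i < k -> 0 < key G a w -> exists u, [/\ F u = i, key G a u < key G a w & G u w].
Proof.
move=> ik w0; have [kV kc] := conn; set t := key G a w.
have tn : t <= #|V| by apply/ltnW/key_lt.
have umbP u y : useful G a u -> G u y -> key G a u < t -> t <= key G a y -> G u w.
  move=> Uu uy ut ty; have /forallP/(_ u)/forallP/(_ w)/forallP/(_ y) := umb.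
  by rewrite Uu uy ut ty.
case: (balanced_card t tn ik) => [[u [/andP[Uu ut] Fu]]|].
  case/loadP=> y uy ty; exists u; split=> //; apply: (umbP u y) => //.
  by case/orP: uy => // /eqP yu; move: ut; rewrite -yu ltnNge ty.
set T := [set u | _] => /kc c; exfalso.
have aT : a \notin T.
  rewrite !inE negb_and; apply/orP; right; apply/negP; case/loadP=> y.
  rewrite -key0P => /eqP->; by rewrite leqNgt w0.
have wT : w \notin T by rewrite !inE ltnn andbF.
have aw : connect (induced_adj G (~: T)) a w by apply: c; rewrite inE.
have aC : a \in ~: T by rewrite inE.
have [u [y [uT Uu uy ut ty]]] := crossing aC w0 aw.
move: uT; rewrite in_setC in_set => /negP[]; apply/andP; split;
  [by rewrite /= Uu | by apply/loadP; exists y; rewrite ?uy ?orbT].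
Qed.

(** Within the class, neighbours of smaller and smaller key lead to key 0, that is into N[a]; this
    is a clique, so all walks can end in the same [u0]. The same two cases give domination. *)
Lemma class_cds i : i < k -> connected_dominating G [set v | F v == i].
Proof.
move=> ik; set C := [set v | _].
have [u0 u0a u0i] := class_meets_source ik.
have near x y : (x == a) || G a x -> (y == a) || G a y -> x != y -> G x y.
  case/orP=> [/eqP->|ax] /orP[/eqP->|ay] xy; rewrite ?eqxx // ?(adjC G x a) // in xy *.
  by move/forallP/(_ x)/forallP/(_ y): simp; rewrite ax ay xy.
split.
- by apply/set0Pn; exists u0; rewrite inE u0i.
- have toU0 x : x \in C -> connect (induced_adj G C) x u0.
    have [m] := ubnP (key G a x); elim: m x => // m IHm x xm xC.
    have [x0|/(class_meets_earlier ik)[u [Fu ux uxG]]] := posnP (key G a x).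
      case: (eqVneq x u0) => [->|xu0]; first exact: connect0.
      apply/connect1/and3P; split=> //; first by rewrite inE u0i.
      by apply: near => //; rewrite -key0P x0.
    have uC : u \in C by rewrite inE Fu.
    apply: connect_trans (IHm u (leq_trans ux _) uC) => //.
    by apply/connect1/and3P; rewrite adjC.
  move=> x y xC yC; apply: connect_trans (toU0 x xC) _.
  by rewrite (sym_connect_sym (induced_adj_sym G C)) toU0.
- move=> v vC; have [v0|/(class_meets_earlier ik)[u [Fu _ uv]]] := posnP (key G a v).
    exists u0; first by rewrite inE u0i.
    apply: near => //; first by rewrite -key0P v0.
    by apply: contraNneq vC => ->; rewrite inE u0i.
  by exists u; rewrite 1?adjC // inE Fu.
Qed.

End GreedySound.

(** * A language of bounded loops and its compilation *)

Inductive hexp : Type :=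
| Num of nat
| Size
| Parts
| Cell of nat & hexp
| Input of hexp
| Plus of hexp & hexp
| Minus of hexp & hexp.

Inductive hcmd : Type :=
| HSet of nat & hexp & hexp
| HSeq of hcmd & hcmd
| HIf of hexp & hcmd
| HFor of nat & bool & hcmd. (* [true]: n iterations; [false]: k iterations *)

(* [st s v] is entry [v] of array number [s]; a scalar variable is entry 0 of an
   array. The arrays are interleaved in memory: [st s v] is stored in cell
   [B + width * v + s], where cell 2 holds [B]. *)
Definition state := nat -> nat -> nat.

Definition put (st : state) s v x : state :=
  fun s' v' => if (s' == s) && (v' == v) then x else st s' v'.

Definition width := 18.

Fixpoint reads_ok (e : hexp) : bool :=
  match e with
  | Cell s e1 => (s < width) && reads_ok e1
  | Input e1 => reads_ok e1
  | Plus e1 e2 | Minus e1 e2 => reads_ok e1 && reads_ok e2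
  | _ => true
  end.

Fixpoint writes (c : hcmd) : seq nat :=
  match c with
  | HSet s _ _ => [:: s]
  | HSeq c1 c2 => writes c1 ++ writes c2
  | HIf _ c1 => writes c1
  | HFor i _ c1 => i :: writes c1
  end.

(** A loop body must leave its counter alone; this makes the number of iterations exact. *)
Fixpoint wf (c : hcmd) : bool :=
  match c with
  | HSet s e1 e2 => [&& s < width, reads_ok e1 & reads_ok e2]
  | HSeq c1 c2 => wf c1 && wf c2
  | HIf e c1 => reads_ok e && wf c1
  | HFor i _ c1 => [&& i < width, i \notin writes c1 & wf c1]
  end.

(** The machine has no multiplication, so the product by [width] is unfolded into additions. *)
Definition offset e s :=
  Add (Read (Const 2)) (Add (iter width (Add e) (Const 0)) (Const s)).

Fixpoint cexp (e : hexp) : expr :=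
  match e with
  | Num x => Const x
  | Size => Read (Const 0)
  | Parts => Read (Const 1)
  | Cell s e1 => Read (offset (cexp e1) s)
  | Input e1 => Read (cexp e1)
  | Plus e1 e2 => Add (cexp e1) (cexp e2)
  | Minus e1 e2 => Defs.Sub (cexp e1) (cexp e2)
  end.

Definition hvar s := Cell s (Num 0).

(** A loop tests the bound minus the counter, which is the number of remaining iterations. *)
Fixpoint ccmd (c : hcmd) : cmd :=
  match c with
  | HSet s e1 e2 => Store (offset (cexp e1) s) (cexp e2)
  | HSeq c1 c2 => Seq (ccmd c1) (ccmd c2)
  | HIf e c1 => If (cexp e) (ccmd c1) Skip
  | HFor i b c1 =>
      Seq (Store (offset (Const 0) i) (Const 0))
          (While (Defs.Sub (cexp (if b then Size else Parts)) (cexp (hvar i)))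
             (Seq (ccmd c1) (Store (offset (Const 0) i) (cexp (Plus (hvar i) (Num 1))))))
  end.

(** Bounds the time as long as every loop runs at most [n] times, so that its guard is evaluated at
    most [n.+1] times. Both branches of a test are charged. *)
Fixpoint time_bound (n : nat) (c : cmd) : nat :=
  match c with
  | Skip => 1
  | Store e1 e2 => (expr_cost e1 + expr_cost e2).+1
  | Seq c1 c2 => (time_bound n c1 + time_bound n c2).+1
  | If e c1 c2 => (expr_cost e + (time_bound n c1 + time_bound n c2)).+1
  | While e c1 => n.+1 * (expr_cost e).+1 + n * time_bound n c1
  end.

(** Sequencing and branching add the exponents, a crude common bound; a loop raises the exponent by
    one. *)
Lemma time_bound_poly (c : cmd) :
  exists C d, forall n, 0 < n -> time_bound n c <= C * n ^ d.
Proof.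
have mono C C' d d' n : 0 < n -> C <= C' -> d <= d' -> C * n ^ d <= C' * n ^ d'.
  by move=> n0 CC dd; rewrite leq_mul // leq_pexp2l.
elim: c => [|e1 e2|c1 [C1 [d1 H1]] c2 [C2 [d2 H2]]
    |e c1 [C1 [d1 H1]] c2 [C2 [d2 H2]]|e c1 [C1 [d1 H1]]].
- by exists 1, 0 => n _.
- by exists (expr_cost e1 + expr_cost e2).+1, 0 => n _; rewrite expn0 muln1.
- exists (C1 + C2).+1, (d1 + d2) => n n0 /=.
  have := H1 n n0; have := H2 n n0.
  have := mono C1 C1 d1 (d1 + d2) n n0 (leqnn _) (leq_addr _ _).
  have := mono C2 C2 d2 (d1 + d2) n n0 (leqnn _) (leq_addl _ _).
  have : 0 < n ^ (d1 + d2) by rewrite expn_gt0 n0.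
  by rewrite mulSn mulnDl; lia.
- exists (expr_cost e + (C1 + C2)).+1, (d1 + d2) => n n0 /=.
  have := H1 n n0; have := H2 n n0.
  have := mono C1 C1 d1 (d1 + d2) n n0 (leqnn _) (leq_addr _ _).
  have := mono C2 C2 d2 (d1 + d2) n n0 (leqnn _) (leq_addl _ _).
  have : 0 < n ^ (d1 + d2) by rewrite expn_gt0 n0.
  have : expr_cost e <= expr_cost e * n ^ (d1 + d2) by rewrite leq_pmulr // expn_gt0 n0.
  by rewrite mulSn !mulnDl; lia.
- exists (2 * (expr_cost e).+1 + C1), d1.+1 => n n0 /=.
  rewrite mulnDl leq_add //.
    have : n <= n ^ d1.+1 by rewrite -[X in X <= _]expn1 leq_pexp2l.
    by move: (expr_cost e) (n ^ _) => x y; nia.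
  by rewrite expnS mulnCA leq_mul2l H1 ?orbT.
Qed.

Lemma offsetE (m : memory) B e s : m 2 = B ->
  eval m (offset e s) = B + (width * eval m e + s).
Proof. by move=> mB; rewrite /offset /= mB /width; lia. Qed.

(** * Execution with a time bound *)

Section Runs.
Variable n : nat.

(** Total correctness including the time, in weakest-precondition form: sequencing becomes nesting
    of postconditions. *)
Definition runs (c : cmd) (m : memory) (Q : memory -> Prop) : Prop :=
  exists t m', [/\ exec c m t m', t <= time_bound n c & Q m'].

Lemma runs_seq c1 c2 m Q :
  runs c1 m (fun m1 => runs c2 m1 Q) -> runs (Seq c1 c2) m Q.
Proof.
case=> t1 [m1 [e1 b1 [t2 [m2 [e2 b2 q]]]]].
exists (t1 + t2).+1, m2; split=> //; first exact: ExecSeq e1 e2.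
by rewrite /= ltnS leq_add.
Qed.

Lemma runs_store e1 e2 m (Q : memory -> Prop) :
  Q (update m (eval m e1) (eval m e2)) -> runs (Store e1 e2) m Q.
Proof.
by move=> q; exists (expr_cost e1 + expr_cost e2).+1, (update m (eval m e1) (eval m e2));
  split=> //; apply: ExecStore.
Qed.

(* The guard is a countdown, so that the loop runs exactly [r] times. *)
Lemma runs_while (Inv : nat -> memory -> Prop) e c r m :
  r <= n -> Inv r m ->
  (forall j m1, j <= r -> Inv j m1 -> eval m1 e = j) ->
  (forall j m1, j < r -> Inv j.+1 m1 -> runs c m1 (Inv j)) ->
  runs (While e c) m (Inv 0).
Proof.
move=> rn Ir guard step.
suff H j m1 : j <= r -> Inv j m1 -> exists t m',
    [/\ exec (While e c) m1 t m', t <= j.+1 * (expr_cost e).+1 + j * time_bound n c & Inv 0 m'].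
  have [t [m' [ex tb q]]] := H r m (leqnn _) Ir; exists t, m'; split=> //=.
  by apply: leq_trans tb _; rewrite leq_add ?leq_mul // ltnS.
elim: j m1 => [|j IHj] m1 jr Ij.
  exists (expr_cost e).+1, m1; split=> //; first exact/ExecWhileFalse/guard/Ij.
  by rewrite mul1n mul0n addn0.
have [t1 [m2 [ex1 b1 I1]]] := step j m1 jr Ij.
have [t2 [m3 [ex2 b2 I2]]] := IHj m2 (ltnW jr) I1.
exists (expr_cost e + t1 + t2).+1, m3; split=> //.
  by apply: ExecWhileTrue ex1 ex2; rewrite (guard j.+1).
by rewrite !mulSn; rewrite mulSn in b2; lia.
Qed.

Lemma runs_weaken c m (Q Q' : memory -> Prop) :
  (forall m', Q m' -> Q' m') -> runs c m Q -> runs c m Q'.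
Proof. by move=> QQ [t [m' [ex b q]]]; exists t, m'; split=> //; apply: QQ. Qed.

End Runs.

(** * Semantics of bounded loops and correctness of the compilation *)

Section Denotation.
Variables (n k B : nat) (inp : nat -> nat).

Definition glue (st : state) : memory := fun a =>
  if a < B then inp a else st ((a - B) %% width) ((a - B) %/ width).

Fixpoint heval (st : state) (e : hexp) : nat :=
  match e with
  | Num x => x
  | Size => n
  | Parts => k
  | Cell s e1 => st s (heval st e1)
  | Input e1 => glue st (heval st e1)
  | Plus e1 e2 => heval st e1 + heval st e2
  | Minus e1 e2 => heval st e1 - heval st e2
  end.

Definition bound (b : bool) := if b then n else k.

Fixpoint run (c : hcmd) (st : state) : state :=
  match c with
  | HSet s e1 e2 => put st s (heval st e1) (heval st e2)
  | HSeq c1 c2 => run c2 (run c1 st)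
  | HIf e c1 => if heval st e != 0 then run c1 st else st
  | HFor i b c1 =>
      iter (bound b) (fun st1 => let st2 := run c1 st1 in put st2 i 0 (st2 i 0 + 1))
           (put st i 0 0)
  end.

Lemma putE st s v x : put st s v x s v = x.
Proof. by rewrite /put !eqxx. Qed.

Lemma run_frame c st s v : s \notin writes c -> run c st s v = st s v.
Proof.
elim: c st => [s' e1 e2|c1 IH1 c2 IH2|e c1 IH|i b c1 IH] st /=.
- by rewrite inE /put => /negPf->.
- by rewrite mem_cat negb_or => /andP[n1 n2]; rewrite IH2 ?IH1.
- by move=> n1; case: ifP => // _; apply: IH.
- rewrite inE negb_or => /andP[/negPf si n1].
  elim: (bound b) => [|m IHm] /=; first by rewrite /put si.
  by rewrite {1}/put si /= IH.
Qed.

(** The counter is reset before the loop and incremented after each body, so the invariant has to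
    survive any change of it. *)
Lemma run_for_ind i b c (Inv : nat -> state -> Prop) st :
  i \notin writes c ->
  (forall j st1 x, Inv j st1 -> Inv j (put st1 i 0 x)) ->
  Inv 0 st ->
  (forall j st1, j < bound b -> st1 i 0 = j -> Inv j st1 -> Inv j.+1 (run c st1)) ->
  Inv (bound b) (run (HFor i b c) st).
Proof.
move=> ic put_inv I0 IS /=.
suff H m : m <= bound b ->
    let st1 := iter m (fun st1 => let st2 := run c st1 in put st2 i 0 (st2 i 0 + 1))
                 (put st i 0 0) in st1 i 0 = m /\ Inv m st1.
  by case: (H _ (leqnn _)).
elim: m => [|m IHm] mb /=; first by rewrite putE; split=> //; apply: put_inv.
have [im Im] := IHm (ltnW mb); rewrite putE run_frame // im addn1; split=> //.
exact/put_inv/IS.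
Qed.

Hypotheses (B2 : 2 < B) (inp0 : inp 0 = n) (inp2 : inp 2 = B) (kn : k <= n).

Lemma glue_offset st s v : s < width -> glue st (B + (width * v + s)) = st s v.
Proof.
move=> sw; rewrite /glue ltnNge leq_addr /= addKn.
by rewrite mulnC modnMDl modn_small // divnMDl // divn_small // addn0.
Qed.

Lemma glue_base m st : m =1 glue st -> m 2 = B.
Proof. by move->; rewrite /glue B2. Qed.

(** Division by [width] recovers array and entry from an address, so distinct entries never share a
    cell. *)
Lemma put_glue m st s v x : m =1 glue st -> s < width ->
  update m (B + (width * v + s)) x =1 glue (put st s v x).
Proof.
move=> mg sw a; rewrite /update mg /glue /put.
case: eqP => [->|ne].
  rewrite ltnNge leq_addr /= addKn.
  by rewrite mulnC modnMDl modn_small // divnMDl // divn_small // addn0 !eqxx.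
case: ltnP => // Ba; case: andP => // -[/eqP ms /eqP dv]; case: ne.
have := divn_eq (a - B) width; rewrite ms dv; lia.
Qed.

Lemma cexpE (inp1 : inp 1 = k) m st e : m =1 glue st -> reads_ok e ->
  eval m (cexp e) = heval st e.
Proof.
move=> mg; elim: e => [x|||s e IH|e IH|e1 IH1 e2 IH2|e1 IH1 e2 IH2] //=.
- by rewrite mg /glue; case: ifP => //; lia.
- by rewrite mg /glue; case: ifP => //; lia.
- move=> /andP[sw ok]; have := offsetE (cexp e) s (glue_base mg) => /= ->.
  by rewrite mg glue_offset // IH.
- by move=> ok; rewrite mg IH.
- by case/andP=> /IH1-> /IH2->.
- by case/andP=> /IH1-> /IH2->.
Qed.

Lemma compile_correct (inp1 : inp 1 = k) c m st : wf c -> m =1 glue st ->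
  runs n (ccmd c) m (fun m' => m' =1 glue (run c st)).
Proof.
elim: c m st => [s e1 e2|c1 IH1 c2 IH2|e c1 IH|i b c1 IH] m st /=.
- case/and3P=> sw ok1 ok2 mg; apply: runs_store.
  by rewrite (offsetE _ _ (glue_base mg)) !(cexpE inp1 mg) //; apply: put_glue.
- case/andP=> w1 w2 mg; apply/runs_seq/(runs_weaken _ (IH1 _ _ w1 mg)).
  by move=> m1; apply: IH2.
- case/andP=> ok w1 mg; rewrite -(cexpE inp1 mg ok); case: eqP => e0 /=.
    exists (expr_cost (cexp e) + 1).+1, m; split=> //; last by rewrite /=; lia.
    exact: ExecIfFalse e0 (ExecSkip m).
  have [t [m' [ex tb q]]] := IH m st w1 mg.
  exists (expr_cost (cexp e) + t).+1, m'; split=> //=; last by lia.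
  by apply: ExecIfTrue ex; apply/eqP.
- case/and3P=> iw ic w1 mg; apply/runs_seq/runs_store.
  have bn : bound b <= n by rewrite /bound; case: (b).
  pose f (st1 : state) := put (run c1 st1) i 0 (run c1 st1 i 0 + 1).
  rewrite -[iter _ _ _]/(iter (bound b) f _); set st0 := put st i 0 0.
  (* [j] counts the remaining iterations, as the guard does; the abstract state is pinned down as an
     iterate of [f]. *)
  pose Inv j m1 := j <= bound b /\ exists2 st1, m1 =1 glue st1 &
    st1 i 0 = bound b - j /\ st1 = iter (bound b - j) f st0.
  apply: (runs_weaken (Q := Inv 0)).
    by move=> m' [_ [st1 mg1 [_ stE]]]; rewrite subn0 in stE; rewrite -stE.
  apply: (runs_while (Inv := Inv) bn).
  + split=> //; exists st0; last by rewrite subnn {1}/st0 putE.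
    by rewrite (offsetE _ _ (glue_base mg)); apply: put_glue.
  + move=> j m1 _ [jb [st1 mg1 [si _]]].
    have ok : reads_ok (Minus (if b then Size else Parts) (hvar i)).
      by rewrite /= iw; case: (b).
    have := cexpE inp1 mg1 ok => /= ->; rewrite si.
    by have -> : heval st1 (if b then Size else Parts) = bound b by [case: (b)]; lia.
  + move=> j m1 jr [jb [st1 mg1 [si stE]]]; apply/runs_seq.
    apply: (runs_weaken _ (IH _ _ w1 mg1)) => m2 mg2; apply/runs_store.
    have ok : reads_ok (Plus (hvar i) (Num 1)) by rewrite /= iw.
    rewrite (offsetE _ _ (glue_base mg2)) (cexpE inp1 mg2 ok) /=.
    have bj : bound b - j = (bound b - j.+1).+1 by lia.
    split; first exact: ltnW.
    exists (f st1); first exact: put_glue.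
    by split; [rewrite /f putE run_frame // si; lia | rewrite bj /= -stE].
Qed.

End Denotation.

(** * The algorithm *)

Notation MAT := 0 (only parsing).
Notation ROW := 1 (only parsing).
Notation MARK := 2 (only parsing).
Notation KEY := 3 (only parsing).
Notation USEFUL := 4 (only parsing).
Notation LOAD := 5 (only parsing).
Notation LABEL := 6 (only parsing).
Notation A_ := 7 (only parsing).
Notation W_ := 8 (only parsing).
Notation X_ := 9 (only parsing).
Notation Y_ := 10 (only parsing).
Notation U_ := 11 (only parsing).
Notation R_ := 12 (only parsing).
Notation OK := 13 (only parsing).
Notation T_ := 14 (only parsing).
Notation V_ := 15 (only parsing).
Notation I_ := 16 (only parsing).
Notation BEST := 17 (only parsing).

Declare Scope hcmd_scope.
Notation "c1 ;; c2" := (HSeq c1 c2) (at level 60, right associativity) : hcmd_scope.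
Local Open Scope hcmd_scope.

(** Nonzero means true, so truncated subtraction supplies all comparisons. *)
Definition ltE e1 e2 := Minus e2 e1.
Definition leE e1 e2 := Minus (Plus e2 (Num 1)) e1.
Definition neqE e1 e2 := Plus (Minus e1 e2) (Minus e2 e1).
Definition notE e := Minus (Num 1) e.
Definition eqE e1 e2 := notE (neqE e1 e2).
Definition adjE e1 e2 := Cell MAT (Plus (Cell ROW e1) e2).
Definition guard es c := foldr HIf c es.

(** [ROW] tabulates the multiples of [n], built by addition, for row-major indexing; the 2 skips the
    cells of [n] and [k]. *)
Definition load_matrix :=
  HFor X_ true
    (HFor Y_ true
       (HSet MAT (Plus (Cell ROW (hvar X_)) (hvar Y_))
          (Input (Plus (Plus (Cell ROW (hvar X_)) (hvar Y_)) (Num 2)))) ;;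
     HSet ROW (Plus (hvar X_) (Num 1)) (Plus (Cell ROW (hvar X_)) Size)) ;;
  HSet MAT (Num 0) (Num 0).

Definition clear s v := HFor v true (HSet s (hvar v) (Num 0)).

Definition spread :=
  HFor Y_ true
    (guard [:: Cell MARK (hvar X_); adjE (hvar X_) (hvar Y_);
               neqE (hvar Y_) (hvar W_); notE (adjE (hvar W_) (hvar Y_))]
       (HSet MARK (hvar Y_) (Num 1))).

Definition mark_source :=
  guard [:: neqE (hvar A_) (hvar W_); notE (adjE (hvar W_) (hvar A_))]
    (HSet MARK (hvar A_) (Num 1)).

(** Rounds of relaxation as in the Bellman-Ford algorithm: each round extends the marks by at least
    one unit of distance from [a]. *)
Definition mark_before :=
  clear MARK X_ ;; mark_source ;; HFor R_ true (HFor X_ true spread).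

Definition record_key :=
  HSet KEY (hvar W_) (Num 0) ;;
  HFor X_ true
    (HSet KEY (hvar W_) (Plus (Cell KEY (hvar W_)) (Cell MARK (hvar X_)))).

Definition record_useful_from :=
  HFor U_ true
    (guard [:: Cell MARK (hvar X_); adjE (hvar X_) (hvar U_);
               adjE (hvar U_) (hvar W_)]
       (HSet USEFUL (hvar U_) (Num 1))).

Definition init_useful :=
  HFor U_ true
    (HSet USEFUL (hvar U_)
       (Plus (eqE (hvar U_) (hvar A_)) (adjE (hvar A_) (hvar U_)))).

Definition prepare :=
  init_useful ;;
  HFor W_ true (mark_before ;; record_key ;; HFor X_ true record_useful_from).

Definition fail_if es := guard es (HSet OK (Num 0) (Num 0)).

Definition check_simplicial_at :=
  HFor Y_ true
    (fail_if [:: adjE (hvar A_) (hvar X_); adjE (hvar A_) (hvar Y_);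
                 neqE (hvar X_) (hvar Y_);
                 notE (adjE (hvar X_) (hvar Y_))]).

Definition check_simplicial := HFor X_ true check_simplicial_at.

Definition check_umbrella_at :=
  HFor Y_ true
    (fail_if [:: Cell USEFUL (hvar U_); adjE (hvar U_) (hvar Y_);
                 ltE (Cell KEY (hvar U_)) (Cell KEY (hvar W_));
                 leE (Cell KEY (hvar W_)) (Cell KEY (hvar Y_));
                 notE (adjE (hvar U_) (hvar W_))]).

Definition check_umbrella_free := HFor U_ true (HFor W_ true check_umbrella_at).

Definition find_best :=
  HSet BEST (Num 0) (Num 0) ;;
  HFor I_ false
    (guard [:: ltE (Cell LOAD (hvar I_)) (Cell LOAD (hvar BEST))]
       (HSet BEST (Num 0) (hvar I_))).

Definition raise_load :=
  HFor Y_ true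
    (guard [:: Plus (eqE (hvar Y_) (hvar V_)) (adjE (hvar V_) (hvar Y_));
               leE (Cell LOAD (hvar BEST)) (Cell KEY (hvar Y_))]
       (HSet LOAD (hvar BEST) (Plus (Cell KEY (hvar Y_)) (Num 1)))).

Definition place :=
  find_best ;; HSet LABEL (hvar V_) (hvar BEST) ;; raise_load.

(** One scan per key value takes the place of sorting; all keys are below [n]. *)
Definition greedy_round :=
  HFor V_ true
    (guard [:: Cell USEFUL (hvar V_); eqE (Cell KEY (hvar V_)) (hvar T_)] place).

(** Vertices that are not useful keep the label 0 given here. *)
Definition greedy := clear LABEL V_ ;; clear LOAD V_ ;; HFor T_ true greedy_round.

(** There is no early exit: the labels of the last vertex passing the tests survive. *)
Definition search :=
  HFor A_ true
    (prepare ;; HSet OK (Num 0) (Num 1) ;; check_simplicial ;;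
     check_umbrella_free ;; HIf (hvar OK) greedy).

Definition algorithm := load_matrix ;; search.

Lemma algorithm_wf : wf algorithm. Proof. by []. Qed.

Lemma index_inj n (x y x' y' : 'I_n) : n * x + y = n * x' + y' -> x = x' /\ y = y'.
Proof.
have n0 : 0 < n := leq_ltn_trans (leq0n x) (ltn_ord x).
move=> E; have := congr1 (divn^~ n) E; have := congr1 (modn^~ n) E => /=.
rewrite ![n * _]mulnC !modnMDl !divnMDl // !divn_small // !modn_small // !addn0.
by move=> /val_inj-> /val_inj->.
Qed.

Lemma index_lt n (x y : 'I_n) : n * x + y < n * n.
Proof. by have := ltn_ord x; have := ltn_ord y; nia. Qed.

(** * Correctness of the phases of the algorithm *)

Section Correctness.
Variables (n k B : nat) (inp : nat -> nat) (G : sgraph 'I_n).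
Notation run := (run n k B inp).
Notation heval := (heval n k B inp).
Implicit Types (st : state) (a u v w x y : 'I_n).

Definition holds st es := all (fun e => heval st e != 0) es.

Lemma run_guard es c st :
  run (guard es c) st = if holds st es then run c st else st.
Proof. by elim: es => //= e es ->; case: ifP => //= ->. Qed.

Lemma holds_nil st : holds st [::]. Proof. by []. Qed.

Lemma holds_cons st e es : holds st (e :: es) = (heval st e != 0) && holds st es.
Proof. by []. Qed.

Lemma run_seq c1 c2 st : run (c1 ;; c2) st = run c2 (run c1 st). Proof. by []. Qed.

Lemma run_set s e1 e2 st :
  run (HSet s e1 e2) st = put st s (heval st e1) (heval st e2).
Proof. by []. Qed.

Lemma run_if e c st :
  run (HIf e c) st = if heval st e != 0 then run c st else st.
Proof. by []. Qed.

Lemma heval_var st s : heval st (hvar s) = st s 0. Proof. by []. Qed.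

Lemma test_lt st e1 e2 : (heval st (ltE e1 e2) != 0) = (heval st e1 < heval st e2).
Proof. by rewrite /= subn_eq0 -ltnNge. Qed.

Lemma test_le st e1 e2 : (heval st (leE e1 e2) != 0) = (heval st e1 <= heval st e2).
Proof. by rewrite /= subn_eq0 -ltnNge addn1. Qed.

Lemma test_neq st e1 e2 : (heval st (neqE e1 e2) != 0) = (heval st e1 != heval st e2).
Proof. by rewrite /= addn_eq0 !subn_eq0 -eqn_leq. Qed.

Lemma test_not st e : (heval st (notE e) != 0) = (heval st e == 0).
Proof. by rewrite /=; case: (heval st e). Qed.

Lemma test_eq st e1 e2 : (heval st (eqE e1 e2) != 0) = (heval st e1 == heval st e2).
Proof. by rewrite test_not -[_ == 0]negbK test_neq negbK. Qed.

Lemma test_plus st e1 e2 :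
  (heval st (Plus e1 e2) != 0) = (heval st e1 != 0) || (heval st e2 != 0).
Proof. by rewrite /= addn_eq0 negb_and. Qed.

Definition testE :=
  (holds_cons, holds_nil, andbT, test_lt, test_le, test_neq, test_not, test_eq, test_plus).

Definition matrix_loaded st :=
  (forall x, st ROW x = n * x) /\ forall x y, st MAT (n * x + y) = G x y.

Lemma adjE_correct st s1 s2 x y :
  matrix_loaded st -> st s1 0 = x -> st s2 0 = y ->
  heval st (adjE (hvar s1) (hvar s2)) = G x y.
Proof. by move=> [rowE matE] /= -> ->; rewrite rowE matE. Qed.

Lemma matrix_frame c st :
  MAT \notin writes c -> ROW \notin writes c ->
  matrix_loaded st -> matrix_loaded (run c st).
Proof.
by move=> nm nr [rowE matE]; split=> [x|x y]; rewrite run_frame.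
Qed.

Lemma for_ord i c (Inv : nat -> state -> Prop) st :
  i \notin writes c ->
  (forall j st1 (x : nat), Inv j st1 -> Inv j (put st1 i 0 x)) ->
  Inv 0 st ->
  (forall (j : 'I_n) st1, st1 i 0 = j -> Inv j st1 -> Inv j.+1 (run c st1)) ->
  Inv n (run (HFor i true c) st).
Proof.
move=> ic pI I0 IS; refine (@run_for_ind n k B inp i true c Inv st ic pI I0 _) => j st1 jn ij.
exact: (IS (Ordinal jn)).
Qed.

Lemma clear_correct s i st x :
  i != s -> run (clear s i) st s x = 0.
Proof.
move=> si; have si' : (s == i) = false by rewrite eq_sym (negPf si).
apply: (for_ord (Inv := fun j st1 => forall x, x < j -> st1 s x = 0)) => //=.
- by rewrite inE.
- by move=> j st1 z H y yj; rewrite /put si' H.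
- move=> j st1 ij H y; rewrite /put eqxx ij ltnS leq_eqVlt => /orP[/eqP->|yj].
    by rewrite eqxx.
  by case: eqP => //= _; apply: H.
Qed.

Section Source.
Variable a : 'I_n.

Section Mark.
Variable w : 'I_n.

Let e := induced_adj G (far G w).

Definition mark_ready st := [/\ matrix_loaded st, st A_ 0 = a & st W_ 0 = w].

(** Marks are required to be exactly 0 or 1 because [record_key] adds them up. *)
Definition mark_sound st := mark_ready st /\
  forall x, st MARK x != 0 -> st MARK x = 1 /\ x \in before G a w.

Lemma mark_source_correct st : mark_sound st -> (forall x, st MARK x = 0) ->
  mark_sound (run mark_source st)
  /\ (a \in far G w -> run mark_source st MARK a != 0).
Proof.
move=> sst m0; have [[ml aE wE] snd] := sst.
have -> : run mark_source st =
    if a \in far G w then put st MARK a 1 else st.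
  rewrite /mark_source run_guard !testE.
  rewrite (adjE_correct ml wE aE) /= aE wE inE eqb0.
  by rewrite -val_eqE.
case: ifP => // aw; split; last by rewrite putE.
split=> // x; rewrite /put /=; case: (eqVneq (x : nat) a) => [/val_inj-> _|_]; last exact: snd.
by split=> //; apply: before_src.
Qed.

Lemma spread_correct st x :
  mark_sound st -> st X_ 0 = x ->
  mark_sound (run spread st) /\
  (forall y, st MARK y != 0 \/ (st MARK x != 0 /\ e x y) -> run spread st MARK y != 0).
Proof.
move=> sst xE.
pose Inv j st1 := [/\ mark_sound st1, st1 X_ 0 = x,
  forall y, st MARK y != 0 -> st1 MARK y != 0 &
  forall y, y < j -> st MARK x != 0 -> e x y -> st1 MARK y != 0].
have : Inv n (run spread st).
  apply: for_ord => //.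
  move=> j st1 jE [ss1 xE1 mono done]; have [[ml aE wE] snd] := ss1.
  rewrite run_guard !testE.
  rewrite (adjE_correct ml xE1 jE) (adjE_correct ml wE jE) /= xE1 jE wE.
  rewrite !eqb0 negbK; case: ifP => [/and4P[mx xj jw wj]|Ng].
    have jB : j \in before G a w.
      by apply: before_step (snd x mx).2 xj _; rewrite inE wj andbT.
    split=> //.
    + split=> // y; rewrite /put /=; case: (eqVneq (y : nat) j) => [/val_inj-> //|_].
      exact: snd.
    + by move=> y /mono my; rewrite /put /=; case: ifP.
    + move=> y; rewrite ltnS leq_eqVlt => /orP[/eqP yj|yj] mx' xy; rewrite /put /=.
        by rewrite yj eqxx.
      by case: ifP => // _; apply: done.
  split=> // y; rewrite ltnS leq_eqVlt => /orP[/eqP yj|]; last exact: done.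
  move=> mx /and3P[_ yw xy]; case/negP: Ng.
  have -> : j = y by apply/val_inj.
  move: yw; rewrite inE (mono _ mx) xy => /andP[yw ->].
  by rewrite /= andbT val_eqE.
case=> ss _ mono done; split=> // y [/mono //|[mx xy]].
by apply: done => //; apply: ltn_ord.
Qed.

(** Soundness holds throughout. For completeness, after [r] rounds the ball of radius [r] in G -
    N[w] is marked, and radius [n] exhausts the component by [connect_ball]. *)
Lemma mark_before_correct st x :
  mark_ready st -> run mark_before st MARK x = (x \in before G a w).
Proof.
move=> rst; set st1 := run (clear MARK X_) st.
have m1 y : st1 MARK y = 0 by apply: clear_correct.
have ss1 : mark_sound st1.
  split=> [|y]; last by rewrite m1.
  case: rst => ml aE wE; split; [exact: matrix_frame | |];
    by rewrite /st1 run_frame.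
have [ss2 m2] := mark_source_correct ss1 m1.
have -> : run mark_before st = run (HFor R_ true (HFor X_ true spread)) (run mark_source st1) by [].
move: (run mark_source st1) ss2 m2 => {st1 m1 ss1 rst} st2 ss2 m2.
pose Inv r st1 := mark_sound st1 /\
  (a \in far G w -> forall y, y \in ball e a r -> st1 MARK y != 0).
have [[_ snd] cmpl] : Inv n (run (HFor R_ true (HFor X_ true spread)) st2).
  apply: for_ord => //.
    by split=> // aw y; rewrite inE => /eqP->; apply: m2.
  move=> r st3 _ [ss3 m3].
  (* Within a round, the vertices below [j] have already spread their marks. *)
  pose Inv' j st1 := [/\ mark_sound st1,
    (a \in far G w -> forall y, y \in ball e a r -> st1 MARK y != 0) &
    a \in far G w -> forall (z y : 'I_n), z < j -> z \in ball e a r -> e z y -> st1 MARK y != 0].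
  have [ss4 m4 m4'] : Inv' n (run (HFor X_ true spread) st3).
    apply: for_ord => //.
    move=> j st5 jE [ss5 m5 m5']; have [ss6 m6] := spread_correct ss5 jE.
    split=> // aw y; first by move=> yr; apply: m6; left; apply: m5.
    move=> y'; rewrite ltnS leq_eqVlt => /orP[/eqP yj|yj] yr yy'; apply: m6.
      by right; have <- : y = j by [apply/val_inj]; split=> //; apply: m5.
    by left; apply: m5' yr yy'.
  split=> // aw y; case/ballS => [/(m4 aw) //|[z zr zy]].
  exact: (m4' aw z).
have [m0|m0] := eqVneq (run (HFor R_ true (HFor X_ true spread)) st2 MARK x) 0;
  last by have [-> ->] := snd x m0.
rewrite m0; apply/esym/eqP; rewrite eqb0; apply/negP => xB; have := xB.
rewrite beforeE connect_ball card_ord => /andP[aw xn].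
by have := cmpl aw x xn; rewrite m0.
Qed.

Lemma record_key_correct st :
  (forall x, st MARK x = (x \in before G a w)) -> st W_ 0 = w ->
  run record_key st KEY w = key G a w
  /\ forall v : nat, v != w -> run record_key st KEY v = st KEY v.
Proof.
move=> mE wE.
pose Inv j st1 := [/\ (forall x : nat, st1 MARK x = st MARK x), st1 W_ 0 = w,
  st1 KEY w = \sum_(0 <= x < j) st MARK x &
  forall v : nat, v != w -> st1 KEY v = st KEY v].
have [_ _ keyE oth] : Inv n (run record_key st).
  rewrite /record_key run_seq; apply: for_ord => //.
    split=> //=; rewrite wE ?putE ?big_geq //.
    by move=> v /negPf vw; rewrite /put /= vw.
  move=> j st1 jE [m1 w1 k1 o1]; split=> //=; rewrite w1 ?putE.
    by rewrite big_nat_recr //= k1 m1 jE.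
  by move=> v vw; rewrite /put /= (negPf vw) o1.
split=> //; rewrite keyE big_mkord /key -sum1_card [RHS]big_mkcond.
by apply: eq_bigr => x _; rewrite mE; case: (x \in _).
Qed.

End Mark.

Definition useful_sound st := forall u, st USEFUL u != 0 -> useful G a u.

Lemma init_useful_correct st :
  matrix_loaded st -> st A_ 0 = a ->
  useful_sound (run init_useful st)
  /\ forall u, (u == a) || G a u -> run init_useful st USEFUL u != 0.
Proof.
move=> ml aE.
pose Inv j st1 := [/\ matrix_loaded st1, st1 A_ 0 = a &
  forall u, u < j -> (st1 USEFUL u != 0) = (u == a) || G a u].
have [_ _ uE] : Inv n (run init_useful st).
  apply: for_ord => //.
  move=> j st1 jE [ml1 aE1 H]; split=> // u.
  rewrite ltnS leq_eqVlt => /orP[/eqP/val_inj-> | uj].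
    rewrite run_set (heval_var st1 U_) jE putE.
    by rewrite test_plus test_eq (adjE_correct ml1 aE1 jE) /= jE aE1 eqb0 negbK.
  rewrite run_set (heval_var st1 U_) jE /put (ltn_eqF uj) andbF; exact: H.
by split=> u; rewrite uE // /useful orbA => ->.
Qed.

Lemma record_useful_from_correct st w x :
  matrix_loaded st -> st W_ 0 = w -> st X_ 0 = x ->
  (forall y, st MARK y = (y \in before G a w)) -> useful_sound st ->
  [/\ useful_sound (run record_useful_from st),
      forall u, st USEFUL u != 0 -> run record_useful_from st USEFUL u != 0 &
      forall u, x \in before G a w -> G x u -> G u w ->
        run record_useful_from st USEFUL u != 0].
Proof.
move=> ml wE xE mE us.
pose Inv j st1 := [/\ [/\ matrix_loaded st1, st1 W_ 0 = w, st1 X_ 0 = x &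
    forall y, st1 MARK y = (y \in before G a w)], useful_sound st1,
  forall u, st USEFUL u != 0 -> st1 USEFUL u != 0 &
  forall u, u < j -> x \in before G a w -> G x u -> G u w -> st1 USEFUL u != 0].
have [_ us1 mono done] : Inv n (run record_useful_from st).
  apply: for_ord => //.
  move=> j st1 jE [[ml1 wE1 xE1 mE1] us1 mono done].
  rewrite run_guard !testE.
  rewrite (adjE_correct ml1 xE1 jE) (adjE_correct ml1 jE wE1) /= xE1 jE mE1 !eqb0 !negbK.
  case: ifP => [/and3P[xB xj jw]|Ng]; split=> //.
  + move=> u; rewrite /put /=; case: (eqVneq (u : nat) j) => [/val_inj-> _|_]; last exact: us1.
    by apply/or3P/Or33/existsP; exists w; apply/existsP; exists x; rewrite xB xj jw.
  + by move=> u /mono; rewrite /put /=; case: ifP.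
  + move=> u; rewrite ltnS leq_eqVlt /put /= => /orP[/eqP->|uj] *; first by rewrite eqxx.
    by case: ifP => // _; apply: done.
  + move=> u; rewrite ltnS leq_eqVlt => /orP[/eqP/val_inj->|]; last exact: done.
    by move=> xB xj jw; rewrite xB xj jw in Ng.
split=> // u; exact: done.
Qed.

Definition prepared st := [/\ matrix_loaded st, st A_ 0 = a,
  forall w, st KEY w = key G a w & forall u, (st USEFUL u != 0) = useful G a u].

(** [USEFUL] never has false positives, and iteration [w] adds all vertices witnessed by [w]; the
    same iteration changes [KEY] at entry [w] only. *)
Lemma prepare_correct st :
  matrix_loaded st -> st A_ 0 = a -> prepared (run prepare st).
Proof.
move=> ml aE; have [us0 u0] := init_useful_correct ml aE.
pose Inv j st1 := [/\ matrix_loaded st1 /\ st1 A_ 0 = a,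
  forall w, w < j -> st1 KEY w = key G a w,
  useful_sound st1,
  forall u, (u == a) || G a u -> st1 USEFUL u != 0 &
  forall w x u, w < j -> x \in before G a w -> G x u -> G u w -> st1 USEFUL u != 0].
have [[ml1 aE1] kE us1 u1 u1'] : Inv n (run prepare st).
  rewrite /prepare run_seq; apply: for_ord => //.
    by split=> //; split; [apply: matrix_frame | rewrite run_frame].
  move=> w st1 wE [[ml1 aE1] kE us1 u1 u1'].
  pose st2 := run mark_before st1; pose st3 := run record_key st2.
  have ml2 : matrix_loaded st2 by apply: matrix_frame.
  have ml3 : matrix_loaded st3 by apply: matrix_frame.
  have wE2 : st2 W_ 0 = w by rewrite /st2 run_frame.
  have mE2 x : st2 MARK x = (x \in before G a w).
    by apply: mark_before_correct; split.
  have [kw kNw] := record_key_correct mE2 wE2.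
  have U3 u : st3 USEFUL u = st1 USEFUL u.
    by rewrite /st3 run_frame // /st2 run_frame.
  pose Inv' j st4 := [/\ [/\ matrix_loaded st4, st4 W_ 0 = w &
      forall y, st4 MARK y = (y \in before G a w)], useful_sound st4,
    forall u, st1 USEFUL u != 0 -> st4 USEFUL u != 0 &
    forall x u, x < j -> x \in before G a w -> G x u -> G u w -> st4 USEFUL u != 0].
  have [_ us4 mono4 u4] : Inv' n (run (HFor X_ true record_useful_from) st3).
    apply: for_ord => //.
      split=> //; last by move=> u; rewrite U3.
        split=> // [|y]; first by rewrite /st3 run_frame.
        by rewrite /st3 run_frame.
      by move=> u; rewrite U3; apply: us1.
    move=> x st5 xE [[ml5 wE5 mE5] us5 mono5 u5].
    have [us6 mono6 u6] := record_useful_from_correct ml5 wE5 xE mE5 us5.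
    split=> //.
    + split; first exact: matrix_frame.
        by rewrite run_frame.
      by move=> y; rewrite run_frame.
    + by move=> u /mono5/mono6.
    + move=> y u; rewrite ltnS leq_eqVlt => /orP[/eqP/val_inj->|yx]; first exact: u6.
      by move=> *; apply/mono6/(u5 y).
  have -> : run (mark_before ;; record_key ;; HFor X_ true record_useful_from) st1
            = run (HFor X_ true record_useful_from) st3 by [].
  split=> //.
  + by split; [apply: matrix_frame | rewrite run_frame // /st3 run_frame // /st2 run_frame].
  + move=> w'; rewrite ltnS run_frame // leq_eqVlt => /orP[/eqP/val_inj->|ww'] //.
    rewrite /st3 kNw; last by rewrite neq_ltn ww'.
    by rewrite /st2 run_frame // kE.
  + by move=> u /u1/mono4.
  + move=> w' x u; rewrite ltnS leq_eqVlt => /orP[/eqP/val_inj->|ww'].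
      by apply: u4; apply: ltn_ord.
    by move=> *; apply/mono4/(u1' w' x).
split=> // [w|u]; first exact/kE/ltn_ord.
apply/idP/idP => [/us1 //|]; rewrite /useful orbA => /orP[/u1 //|].
by case/existsP=> w /existsP[x /and3P[xB xu uw]]; apply: (u1' w x).
Qed.

(** A loop of tests on [OK] computes a universal quantifier. For nested loops, [Q] carries the
    values of the outer counters. *)
Lemma for_all i c (Q : state -> Prop) (P : pred 'I_n) st :
  i \notin writes c -> i != OK ->
  (forall st1 (x : nat), Q st1 -> Q (put st1 i 0 x)) ->
  Q st ->
  (forall (j : 'I_n) st1, st1 i 0 = j -> Q st1 ->
     Q (run c st1) /\ (run c st1 OK 0 != 0) = (st1 OK 0 != 0) && P j) ->
  Q (run (HFor i true c) st)
  /\ (run (HFor i true c) st OK 0 != 0) = (st OK 0 != 0) && [forall x, P x].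
Proof.
move=> ic iok pQ Q0 QS.
pose Inv j st1 := Q st1 /\
  (st1 OK 0 != 0) = (st OK 0 != 0) && [forall x : 'I_n, (x < j) ==> P x].
have [Q1 ->] : Inv n (run (HFor i true c) st).
  apply: for_ord => //.
  - move=> j st1 x [Q1 okE]; split; first exact: pQ.
    by rewrite -okE /put (_ : (OK == i) = false) // eq_sym (negPf iok).
  - split=> //; rewrite -[LHS]andbT; congr (_ && _).
    by apply/esym/forallP.
  - move=> j st1 ij [Q1 okE]; have [Q2 okE2] := QS j st1 ij Q1; split=> //.
    rewrite okE2 okE -andbA; congr (_ && _); apply/andP/forallP => [[/forallP Pj Px] x|Px].
      apply/implyP; rewrite ltnS leq_eqVlt => /orP[/eqP/val_inj-> //|].
      exact/implyP.
    split; last by have := Px j; rewrite ltnSn.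
    by apply/forallP=> x; apply/implyP=> xj; have := Px x; rewrite ltnW.
split=> //; congr (_ && _); apply: eq_forallb => x; by rewrite ltn_ord.
Qed.

Lemma fail_if_ok es st :
  (run (fail_if es) st OK 0 != 0)
  = (st OK 0 != 0) && ~~ holds st es.
Proof. by rewrite /fail_if run_guard; case: ifP; rewrite ?andbF ?andbT //= putE. Qed.

Lemma fail_if_prepared es st : prepared st -> prepared (run (fail_if es) st).
Proof. by rewrite /fail_if run_guard; case: ifP. Qed.

Lemma fail_if_frame es st s : s != OK -> run (fail_if es) st s = st s.
Proof. by rewrite /fail_if run_guard /= /put; case: ifP => // _ /negPf->. Qed.

Lemma check_simplicial_correct st : prepared st ->
  prepared (run check_simplicial st)
  /\ (run check_simplicial st OK 0 != 0) = (st OK 0 != 0) && simplicial G a.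
Proof.
move=> pst; apply: (for_all (Q := prepared)) => // x st1 xE p1.
suff [[]] : (prepared (run check_simplicial_at st1)
    /\ run check_simplicial_at st1 X_ 0 = x) /\
    (run check_simplicial_at st1 OK 0 != 0) = (st1 OK 0 != 0) &&
      [forall y, [&& G a x, G a y & x != y] ==> G x y] by [].
apply: (for_all (Q := fun st1 => prepared st1 /\ st1 X_ 0 = x)) => // y st2 yE [p2 xE2].
split; first by split; [exact: fail_if_prepared | rewrite fail_if_frame].
have [ml aE _ _] := p2.
rewrite fail_if_ok; congr (_ && _); rewrite !testE.
rewrite (adjE_correct ml aE xE2) (adjE_correct ml aE yE) (adjE_correct ml xE2 yE).
rewrite !heval_var xE2 yE !eqb0 !negbK val_eqE.
by rewrite implybE !negb_and !negbK -!orbA.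
Qed.

Lemma check_umbrella_free_correct st : prepared st ->
  prepared (run check_umbrella_free st)
  /\ (run check_umbrella_free st OK 0 != 0) = (st OK 0 != 0) && umbrella_free G a.
Proof.
move=> pst; apply: (for_all (Q := prepared)) => // u st1 uE p1.
set c := HFor _ _ _.
suff [[]] : (prepared (run c st1) /\ run c st1 U_ 0 = u) /\
    (run c st1 OK 0 != 0) = (st1 OK 0 != 0) && [forall w, forall y,
      [&& useful G a u, G u y, key G a u < key G a w & key G a w <= key G a y] ==> G u w]
  by [].
apply: (for_all (Q := fun st1 => prepared st1 /\ st1 U_ 0 = u)) => // w st2 wE [p2 uE2].
set c' := check_umbrella_at.
suff [[? []]] : (prepared (run c' st2) /\ run c' st2 U_ 0 = u /\ run c' st2 W_ 0 = w) /\
    (run c' st2 OK 0 != 0) = (st2 OK 0 != 0) && [forall y,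
      [&& useful G a u, G u y, key G a u < key G a w & key G a w <= key G a y] ==> G u w]
  by [].
apply: (for_all (Q := fun st1 => prepared st1 /\ st1 U_ 0 = u /\ st1 W_ 0 = w)) => //.
move=> y st3 yE [p3 [uE3 wE3]].
split; first by rewrite !fail_if_frame //; split=> //; exact: fail_if_prepared.
have [ml aE kE UE] := p3.
rewrite fail_if_ok; congr (_ && _); rewrite !testE.
rewrite (adjE_correct ml uE3 yE) (adjE_correct ml uE3 wE3).
rewrite /= uE3 wE3 yE !kE UE !eqb0 !negbK.
by rewrite implybE !negb_and negbK -!orbA.
Qed.

(** * Greedy placement into a least loaded class *)

Section Greedy.
Hypotheses (k0 : 0 < k) (kn : k <= n).

(** [P] holds the vertices placed so far, and for [i < k], [L i] is the maximum load in class [i],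
    or 0. The last clause is the effect of always choosing a least loaded class. *)
Definition greedy_inv (P : pred 'I_n) (F : 'I_n -> nat) (L : nat -> nat) : Prop :=
  [/\ forall u, F u < k,
      forall u, P u -> load G a u <= L (F u),
      forall i s, i < k -> s < L i -> exists u, [/\ P u, F u = i & s < load G a u] &
      forall i s, i < k -> L i <= s ->
        {in [pred u | P u && (s < load G a u)] &, injective F}].

(** Suppose some class still has load at most [s] afterwards. Then so had the least loaded class [b]
    before, so no vertex in it had load above [s], and [v] collides with none that has. *)
Lemma greedy_step P F L v F' L' b :
  greedy_inv P F L -> ~~ P v -> b < k -> (forall i, i < k -> L b <= L i) ->
  F' v = b -> (forall u, u != v -> F' u = F u) ->
  (forall i, i != b -> L' i = L i) -> L b <= L' b -> load G a v <= L' b ->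
  (forall s, s < L' b -> s < L b \/ s < load G a v) ->
  greedy_inv [pred u | P u || (u == v)] F' L'.
Proof.
move=> [Fk Pl Ll inj] Pv bk bmin F'v F'u L'i Lb lv L'b.
have PF u : P u -> F' u = F u by move=> Pu; apply: F'u; apply: contraNneq Pv => <-.
have LL i : L i <= L' i by case: (eqVneq i b) => [->|/L'i->].
split.
- by move=> u; case: (eqVneq u v) => [->|/F'u->] //; rewrite F'v.
- move=> u /= /orP[Pu|/eqP->]; last by rewrite F'v.
  by rewrite PF //; apply: leq_trans (LL _); apply: Pl.
- move=> i s ik si; have old : s < L i -> exists u,
      [/\ [pred u | P u || (u == v)] u, F' u = i & s < load G a u].
    by case/(Ll i s ik)=> u [Pu Fu su]; exists u; rewrite /= Pu PF.
  case: (eqVneq i b) => [ib|/L'i Li]; last by apply: old; rewrite -Li.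
  have := si; rewrite {1}ib => /L'b[sb|sv]; first by apply: old; rewrite ib.
  by exists v; rewrite /= eqxx orbT F'v ib.
- move=> i s ik Lis; have Lbs : L b <= s.
    by apply: leq_trans (bmin i ik) (leq_trans (LL i) Lis).
  have new u : P u -> s < load G a u -> F' u != b.
    move=> Pu su; rewrite PF //; apply/eqP => Fu.
    by have := leq_trans su (Pl u Pu); rewrite Fu ltnNge Lbs.
  have injP := inj i s ik (leq_trans (LL i) Lis).
  move=> x y; rewrite !inE => /andP[/orP[Px|/eqP->] sx] /andP[/orP[Py|/eqP->] sy] //.
  + by rewrite !PF //; apply: injP; rewrite inE ?Px ?Py.
  + by rewrite F'v => /eqP; rewrite (negPf (new x Px sx)).
  + by rewrite F'v => /eqP; rewrite eq_sym (negPf (new y Py sy)).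
Qed.

Lemma greedy_inv_ext P P' F F' L L' :
  P =1 P' -> F =1 F' -> L =1 L' -> greedy_inv P F L -> greedy_inv P' F' L'.
Proof.
move=> PP FF LL [Fk Pl Ll inj]; split=> [u|u|i s ik|i s ik].
- by rewrite -FF.
- by rewrite -PP -FF -LL; apply: Pl.
- by rewrite -LL => /(Ll i s ik)[u [Pu Fu su]]; exists u; rewrite -PP -FF.
- rewrite -LL => /(inj i s ik) injP x y; rewrite !inE -!PP -!FF => xP yP.
  by apply: injP; rewrite inE.
Qed.

Lemma greedy_inv_balanced t F L :
  greedy_inv (light G a t) F L -> balanced G a k F t.
Proof.
move=> [_ _ Ll inj] s i ik; case: (ltnP s (L i)) => [/(Ll i s ik)|/(inj i s ik)];
  by [left | right].
Qed.

Lemma balanced_ext t F F' : (forall u, light G a t u -> F u = F' u) ->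
  balanced G a k F t -> balanced G a k F' t.
Proof.
move=> FF bal s i ik; case: (bal s i ik) => [[u [ut Fu su]]|inj]; [left|right].
  by exists u; rewrite -FF.
move=> x y; rewrite !inE => xT yT; have [/andP[xl _] /andP[yl _]] := (xT, yT).
by rewrite -!FF //; apply: inj; rewrite inE.
Qed.

Lemma find_best_correct st :
  let b := run find_best st BEST 0 in
  b < k /\ forall i, i < k -> st LOAD b <= st LOAD i.
Proof.
pose Inv j st1 := [/\ forall i, st1 LOAD i = st LOAD i, st1 BEST 0 < k &
  forall i, i < j -> st LOAD (st1 BEST 0) <= st LOAD i].
have [_ bk bmin] : Inv k (run find_best st).
  rewrite /find_best run_seq.
  apply: (@run_for_ind n k B inp I_ false _ Inv) => // j st1 jk jE [lE bk bmin].
  rewrite run_guard !testE [heval _ _]/= [X in _ < X]/= !lE jE.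
  case: ltnP => jb; split=> //.
  - by rewrite run_set putE heval_var jE.
  - move=> i; rewrite run_set putE heval_var jE ltnS leq_eqVlt => /orP[/eqP->|/bmin bi] //.
    exact: leq_trans (ltnW jb) bi.
  - by move=> i; rewrite ltnS leq_eqVlt => /orP[/eqP->|/bmin].
by split.
Qed.

Lemma raise_load_correct v st b :
  prepared st -> st V_ 0 = v -> st BEST 0 = b ->
  let st' := run raise_load st in
  [/\ forall i, i != b -> st' LOAD i = st LOAD i,
      st LOAD b <= st' LOAD b, load G a v <= st' LOAD b &
      forall s, s < st' LOAD b -> s < st LOAD b \/ s < load G a v].
Proof.
move=> pst vE bE.
pose Inv j st1 := [/\ [/\ prepared st1, st1 V_ 0 = v & st1 BEST 0 = b],
  forall i, i != b -> st1 LOAD i = st LOAD i,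
  st LOAD b <= st1 LOAD b,
  forall y, y < j -> (y == v) || G v y -> key G a y < st1 LOAD b &
  forall s, s < st1 LOAD b -> s < st LOAD b \/ s < load G a v].
have [_ oth low done up] : Inv n (run raise_load st).
  apply: for_ord => // [|j st1 jE [[p1 vE1 bE1] oth low done up]]; first by split=> // s; left.
  have [ml aE kE uE] := p1.
  rewrite run_guard !testE (adjE_correct ml vE1 jE) !heval_var jE vE1 eqb0 negbK val_eqE.
  rewrite [X in _ && (X <= _)]/= [X in _ && (_ <= X)]/= bE1 jE kE.
  case: ifP => [/andP[vj lk]|Ng]; rewrite ?run_set ?(heval_var st1 BEST) ?bE1.
    rewrite [heval _ _]/= jE kE addn1; split=> //.
    - by move=> i ib; rewrite /put /= (negPf ib) oth.
    - by rewrite putE; apply: leq_trans low (leq_trans lk _).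
    - move=> y; rewrite putE ltnS leq_eqVlt => /orP[/eqP/val_inj-> //|yj] vy.
      by apply: leq_trans (done y yj vy) _; apply: leqW.
    - move=> s; rewrite putE ltnS => sk; right; apply/loadP; by exists j.
  split=> // y; rewrite ltnS leq_eqVlt => /orP[/eqP/val_inj->|]; last exact: done.
  by move=> vj; rewrite ltnNge; move: Ng; rewrite vj /= => ->.
split=> //; case lE : (load G a v) => [//|s].
have /loadP[y vy sy] : s < load G a v by rewrite lE.
exact: leq_ltn_trans sy (done y (ltn_ord y) vy).
Qed.

Definition labels st : 'I_n -> nat := fun u => st LABEL u.

Lemma place_correct P v st :
  prepared st -> st V_ 0 = v -> ~~ P v ->
  greedy_inv P (labels st) (st LOAD) ->
  let st' := run place st in
  greedy_inv [pred u | P u || (u == v)] (labels st') (st' LOAD)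
  /\ forall u, u != v -> labels st' u = labels st u.
Proof.
move=> pst vE Pv gst st'; pose st1 := run find_best st.
have [bk bmin] := find_best_correct st.
pose b := st1 BEST 0; pose st2 := put st1 LABEL v b.
have vE1 : st1 V_ 0 = v by rewrite /st1 run_frame.
have st'E : st' = run raise_load st2.
  by rewrite /st' /place !run_seq run_set (heval_var st1 V_) vE1.
have p2 : prepared st2.
  have [ml aE kE uE] := pst; split.
  - exact: (@matrix_frame find_best st).
  - by rewrite -aE; apply: (@run_frame n k B inp find_best).
  - by move=> w; rewrite -kE; apply: (@run_frame n k B inp find_best).
  - by move=> u; rewrite -uE; congr (_ != 0); apply: (@run_frame n k B inp find_best).
have LE : st2 LOAD =1 st LOAD by move=> i; apply: (@run_frame n k B inp find_best).
have [oth low lv up] := raise_load_correct p2 (vE1 : st2 V_ 0 = v) (erefl : st2 BEST 0 = b).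
have F'E u : labels st' u = st2 LABEL u by rewrite /labels st'E run_frame.
have F'u u : u != v -> labels st' u = labels st u.
  move=> uv; rewrite F'E /st2 /put /= (_ : (u == v :> nat) = false); last exact/negbTE.
  by apply: (@run_frame n k B inp find_best).
split=> //; apply: (greedy_step (b := b) gst) => //.
- by rewrite F'E /st2 putE.
- by move=> i ib; rewrite st'E oth.
- by rewrite st'E -(LE b).
- by rewrite st'E.
- by move=> s; rewrite st'E => /up; rewrite LE.
Qed.

Lemma prepared_frame c st :
  ~~ has (mem [:: MAT; ROW; A_; KEY; USEFUL]) (writes c) ->
  prepared st -> prepared (run c st).
Proof.
move=> /hasPn nw [ml aE kE uE].
have fr s (v : nat) : s \in [:: MAT; ROW; A_; KEY; USEFUL] -> run c st s v = st s v.
  by move=> sI; apply: run_frame; apply: contraL sI; apply: nw.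
split; [|by rewrite fr|by move=> w; rewrite fr|by move=> u; rewrite fr].
by apply: matrix_frame => //; apply/negP => /nw.
Qed.

Lemma greedy_correct st : prepared st ->
  let st' := run greedy st in
  (forall u, labels st' u < k) /\ forall t, t <= n -> balanced G a k (labels st') t.
Proof.
move=> pst; rewrite /greedy !run_seq.
set st0 := run (clear LOAD V_) _.
have p0 : prepared st0 by do 2! apply: prepared_frame => //.
have l0 i : i < n -> st0 LOAD i = 0.
  by move=> li; apply: (@clear_correct _ _ _ (Ordinal li)).
have F0 u : labels st0 u = 0.
  by rewrite /labels /st0 run_frame //; apply: clear_correct.
(* Balance is recorded for each threshold when it is reached, since [greedy_inv] later speaks of a
   larger set of vertices. *)
pose Inv t st1 := [/\ prepared st1, greedy_inv (light G a t) (labels st1) (st1 LOAD) &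
  forall t', t' <= t -> balanced G a k (labels st1) t'].
suff [_ [Fk _ _ _] bal] : Inv n (run (HFor T_ true greedy_round) st0).
  by split.
apply: for_ord => //.
  split=> // [|t' ]; last first.
    by rewrite leqn0 => /eqP-> s i _; right=> x y; rewrite !inE ltn0 andbF.
  split=> [u|u|i s ik|i s _ _ x y]; rewrite ?F0 //.
  - by rewrite /= ltn0 andbF.
  - by rewrite l0 // (leq_trans ik kn).
  - by rewrite !inE ltn0 andbF.
move=> t st1 tE [p1 g1 bal1].
(* During the round for key [t]: all smaller keys are done, and of key [t] the vertices below
   [j]. *)
pose P j := [pred u : 'I_n | useful G a u &&
  ((key G a u < t) || (key G a u == t) && (u < j))].
pose Inv' j st2 := [/\ prepared st2, st2 T_ 0 = t,
  greedy_inv (P j) (labels st2) (st2 LOAD) &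
  forall t', t' <= t -> balanced G a k (labels st2) t'].
suff [p2 _ g2 bal2] : Inv' n (run greedy_round st1).
  have g2' : greedy_inv (light G a t.+1) (labels (run greedy_round st1))
      (run greedy_round st1 LOAD).
    apply: greedy_inv_ext g2 => // u.
    by rewrite /P /light /= ltn_ord andbT ltnS [in RHS]leq_eqVlt orbC.
  split=> // t'; rewrite leq_eqVlt ltnS => /orP[/eqP->|/bal2 //].
  exact: greedy_inv_balanced g2'.
apply: for_ord => //.
  split=> //; apply: greedy_inv_ext g1 => // u.
  by rewrite /P /light /= ltn0 andbF orbF.
move=> v st2 vE [p2 tE2 g2 bal2]; have [_ _ kE uE] := p2.
rewrite run_guard !testE [heval _ _]/= [heval _ (Cell KEY _)]/= heval_var vE tE2 uE kE.
case: ifP => [/andP[Uv /eqP vt]|Nv]; last first.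
  split=> //; apply: greedy_inv_ext g2 => // u; rewrite /P /=.
  case: (eqVneq (key G a u) t) => [ut|//].
  rewrite !andTb ltnS (leq_eqVlt u v); case: (eqVneq (u : nat) v) => [/val_inj uv|//].
  by rewrite uv ltnn; move: Nv; rewrite -uv ut eqxx andbT => ->.
have PNv : ~~ P v v by rewrite /P /= vt !ltnn andbF orbF andbF.
have [g3 F3] := place_correct p2 vE PNv g2.
split.
- exact: prepared_frame.
- by rewrite run_frame.
- apply: greedy_inv_ext g3 => // u; rewrite /P /=.
  case: (eqVneq u v) => [->|uv]; first by rewrite Uv vt eqxx ltnS leqnn !orbT.
  by rewrite orbF ltnS (leq_eqVlt u v) val_eqE (negPf uv).
(* [v] has key [t], so it is not light at any threshold up to [t], and the light vertices keep their
   labels. *)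
- move=> t' t't; apply: balanced_ext (bal2 t' t't) => u /andP[_ ut].
  by rewrite F3 //; apply: contraTneq ut => ->; rewrite vt -leqNgt.
Qed.
End Greedy.

End Source.

(** * The search over all vertices and the loading of the matrix *)

Definition solved st :=
  (forall v, st LABEL v < k)
  /\ forall i, i < k -> connected_dominating G [set v : 'I_n | st LABEL v == i].

(** Any vertex passing both tests, leftmost or not, gives a valid labelling; a later one replaces it
    by another valid labelling, and a failing one leaves the labels alone. *)
Lemma search_correct st a :
  0 < k -> k_connected G k -> simplicial G a -> umbrella_free G a ->
  matrix_loaded st -> solved (run search st).
Proof.
move=> k0 conn sa ua ml; have kn : k <= n by case: conn; rewrite card_ord => /ltnW.
pose Inv j st1 := matrix_loaded st1 /\
  ((exists2 a' : 'I_n, a' < j & simplicial G a' && umbrella_free G a') -> solved st1).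
suff [_] : Inv n (run search st) by apply; exists a; rewrite ?sa ?ua.
apply: for_ord => //; first by split=> // -[].
move=> a' st1 aE [ml1 sol1]; rewrite !run_seq.
set st2 := run (HSet _ _ _) _.
have [ml2 aE2 kE2 uE2] := prepare_correct ml1 aE.
have p2 : prepared a' st2 by [].
have [p3 ok3] := check_simplicial_correct p2.
have [p4 ok4] := check_umbrella_free_correct p3.
move: p4 ok4; set st4 := run check_umbrella_free _ => p4.
rewrite ok3 (_ : st2 OK 0 != 0) // andTb => ok4.
have lab4 v : st4 LABEL v = st1 LABEL v.
  by rewrite /st4 !run_frame // /st2 !run_frame.
rewrite run_if heval_var ok4; case: ifP => [/andP[sa' ua']|Na'].
  split; first by apply: matrix_frame => //; case: p4.
  have [Fk bal] := greedy_correct k0 kn p4 => _; split=> // i ik.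
  by apply: (class_cds sa' ua' conn Fk) => // t; rewrite card_ord; apply: bal.
split=> [|[a2]]; first by case: p4.
rewrite ltnS leq_eqVlt => /orP[/eqP/val_inj->|a2a']; first by rewrite Na'.
move=> ga2; have [Fk cds] : solved st1 by apply: sol1; exists a2.
split=> [v|i ik]; first by rewrite lab4.
have := cds i ik; congr (connected_dominating G _).
by apply/setP=> v; rewrite !inE lab4.
Qed.

Hypothesis nn : n * n + 2 <= B.
(** Position 0 is left out because its cell, number 2, is reserved for the base address. *)
Hypothesis inpE : forall p, 0 < p < n * n ->
  inp (p + 2) = [exists i : 'I_n, exists j : 'I_n, (p == n * i + j) && G i j].

Lemma load_matrix_correct st :
  (forall s (v : nat), st s v = 0) -> matrix_loaded (run load_matrix st).
Proof.
move=> st0.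
have n2 x y : inp (n * x + y + 2) = if n * x + y == 0 then inp 2 else G x y.
  case: eqP => [->//|/eqP p0]; rewrite inpE ?index_lt ?andbT ?lt0n //.
  congr nat_of_bool; apply/existsP/idP => [[i /existsP[j /andP[/eqP/index_inj[-> ->]]]]//|xy].
  by exists x; apply/existsP; exists y; rewrite eqxx.
pose Inv j st1 := (forall x, x <= j -> st1 ROW x = n * x) /\
  forall p, p < n * j -> st1 MAT p = inp (p + 2).
rewrite /load_matrix run_seq; set c := HFor _ _ _.
have [rowE matE] : Inv n (run c st).
  apply: for_ord => //.
    split=> [x|p]; last by rewrite muln0. by rewrite leqn0 => /eqP->; rewrite muln0 st0.
  move=> x st1 xE [rowE matE]; rewrite run_seq.
  set cy := HFor _ _ _.
  pose Inv' j st2 := [/\ st2 X_ 0 = x, forall x, st2 ROW x = st1 ROW x &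
    forall p, p < n * x + j -> st2 MAT p = inp (p + 2)].
  have [xE2 rE2 mE2] : Inv' n (run cy st1).
    apply: for_ord => //.
      by split=> // p; rewrite addn0; apply: matE.
    move=> y st2 yE [xE2 rE2 mE2]; split=> // p.
    rewrite run_set /put [heval _ (Plus _ _)]/= xE2 yE rE2 rowE // addnS ltnS leq_eqVlt.
    case: eqP => [->|_] /=; last exact: mE2.
    move=> _; rewrite /glue xE2 yE rE2 rowE // ifT //.
    by apply: leq_trans nn; rewrite -addSn leq_add2r; apply: index_lt.
  move: (run cy st1) xE2 rE2 mE2 => st2 xE2 rE2 mE2.
  rewrite run_set [heval _ (Plus _ _)]/= [heval _ (Plus _ _)]/= xE2 rE2 rowE //.
  split=> [y|p].
    rewrite /put /= addn1 leq_eqVlt ltnS => /orP[/eqP->|yx]; first by rewrite eqxx mulnS addnC.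
    by rewrite ltn_eqF // rE2 rowE.
  by rewrite mulnS addnC /put /=; apply: mE2.
move: (run c st) rowE matE => st1 rowE matE.
rewrite run_set; split=> [x|x y].
  by rewrite /put /= rowE // ltnW.
rewrite /put /=; case: eqP => [p0|/eqP p0].
  (* Index 0 is the diagonal entry (0, 0), so the final assignment of 0 is right. *)
  have [x0 y0] : (x : nat) = 0 /\ (y : nat) = 0.
    by have := ltn_ord x; move: p0; nia.
  by rewrite (_ : x = y) ?adj_irrefl //; apply/val_inj; rewrite /= x0 y0.
by rewrite matE ?index_lt // n2 (negPf p0).
Qed.

Lemma algorithm_correct st a :
  0 < k -> k_connected G k -> simplicial G a -> umbrella_free G a ->
  (forall s (v : nat), st s v = 0) -> solved (run algorithm st).
Proof.
by move=> k0 conn sa ua st0; apply: search_correct sa ua (load_matrix_correct st0).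
Qed.

End Correctness.

(** * The random-access program *)

(* Cells 2 and n + 3 hold the diagonal entries (0, 0) and (1, 1) of the adjacency
   matrix, hence 0, and can serve as variables below the input's end. Cell 2 is
   left with the base address and the entry (0, 0) is repaired by [load_matrix]. *)
Definition row_counter := Add (Read (Const 0)) (Const 3).

Definition set_base :=
  Seq (While (Defs.Sub (Read (Const 0)) (Read row_counter))
         (Seq (Store (Const 2) (Add (Read (Const 2)) (Read (Const 0))))
            (Store row_counter (Add (Read row_counter) (Const 1)))))
    (Seq (Store row_counter (Const 0))
       (Store (Const 2) (Add (Read (Const 2)) (Const 2)))).

Definition output_label e := Read (offset e LABEL).

(* The label of vertex 2 is written last since it overwrites the base address. *)
Definition output :=
  Seq (Store (offset (Const 0) T_) (Defs.Sub (Read (Const 0)) (Const 3)))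
 (Seq (While (cexp (hvar T_))
         (Seq (Store (Add (cexp (hvar T_)) (Const 2))
                 (output_label (Add (cexp (hvar T_)) (Const 2))))
            (Store (offset (Const 0) T_) (Defs.Sub (cexp (hvar T_)) (Const 1)))))
 (Seq (Store (Const 0) (output_label (Const 0)))
 (Seq (Store (Const 1) (output_label (Const 1)))
      (Store (Const 2) (output_label (Const 2)))))).

Definition cds_program := Seq set_base (Seq (ccmd algorithm) output).

Section Program.
Variables (n k : nat) (G : sgraph 'I_n).
Hypothesis n1 : 1 < n.

Let base := n * n + 2.

Definition based_input a := if a == 2 then base else encode G k a.

Lemma encode_diag (i : nat) : i < 2 -> encode G k (i * n + i).+2 = 0.
Proof.
move=> i2 /=; apply/eqP; rewrite eqb0; apply/existsP => -[x /existsP[y /andP[/eqP xy]]].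
have iin : i < n by apply: leq_trans n1.
have [xi yi] : (x : nat) = i /\ (y : nat) = i.
  have /index_inj[<- <-//] : n * Ordinal iin + Ordinal iin = n * x + y.
  by rewrite /= mulnC.
by rewrite (_ : x = y) ?adj_irrefl //; apply/val_inj; rewrite /= xi yi.
Qed.

(** Memory beyond the input is 0, which provides the all-zero initial state of the arrays. *)
Lemma encode_out a : base <= a -> encode G k a = 0.
Proof.
rewrite /base; case: a => [|[|a]] ba; [lia | lia |].
rewrite /=; apply/eqP; rewrite eqb0; apply/existsP => -[x /existsP[y /andP[/eqP xy _]]].
have := index_lt x y; rewrite -xy; lia.
Qed.

Lemma set_base_correct :
  runs n set_base (encode G k)
    (fun m => m =1 glue base based_input (fun _ _ => 0)).
Proof.
(* [j] additions of [n] to cell 2 remain; the cell [n + 3] counts those made. *)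
pose Inv j m := j <= n /\ forall a, m a =
  if a == 2 then n * (n - j) else if a == n + 3 then n - j else encode G k a.
have e2 : encode G k 2 = 0 by apply: (@encode_diag 0).
have e3 : encode G k (n + 3) = 0.
  by have := @encode_diag 1 isT; rewrite mul1n addn1 addn3.
have n32 : (n + 3 == 2) = false by apply/eqP; lia.
have n30 : (0 == n + 3) = false by apply/eqP; lia.
apply: runs_seq; apply: (runs_weaken (Q := Inv 0)); last first.
  apply: (runs_while (Inv := Inv) (leqnn n)).
  - split=> // a; rewrite subnn muln0; case: eqP => [->//|_].
    by case: eqP => [->|].
  - move=> j m jn [_ mE]; rewrite /= !mE /= n30 n32 eqxx; lia.
  - move=> j m jn [_ mE]; apply/runs_seq/runs_store/runs_store.
    rewrite /= !mE /= n30; split; first exact: ltnW.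
    move=> a; rewrite /update /= !mE /= n30 n32 eqxx.
    case: (eqVneq a 2) => [->|a2]; first by rewrite eq_sym n32; nia.
    by case: eqP => // _; lia.
move=> m [_ mE]; apply/runs_seq/runs_store/runs_store => a.
rewrite /update /= !mE /= n30 subn0 (eq_sym 2) n32.
rewrite /glue /based_input; case: (eqVneq a 2) => [->|a2].
  by rewrite ifT // /base; lia.
case: eqP => [->|_]; last by case: ltnP => // /encode_out.
by rewrite e3; case: ifP.
Qed.

(** All cells written for the output lie below [base], so the labels still to be copied stay
    intact. *)
Lemma output_correct (inp : nat -> nat) (st : state) m :
  inp 0 = n -> inp 2 = base -> m =1 glue base inp st ->
  runs n output m (fun m' => forall v, v < n -> m' v = st LABEL v).
Proof.
move=> inp0 inp2 mg; have B2 : 2 < base by rewrite /base; nia.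
have nB : n < base by rewrite /base; nia.
have B0 : (base + (width * 0 + T_) == 2) = false by apply/eqP; lia.
(* At counter [j] the vertices above [j + 2] are done. From [n - 3], truncated to 0 for small [n],
   the loop serves the vertices [n - 1] down to 3. *)
pose Inv j m1 := [/\ j <= n - 3, m1 0 = n, m1 2 = base, m1 (base + (width * 0 + T_)) = j &
  (forall v, m1 (base + (width * v + LABEL)) = st LABEL v) /\
  forall v, j + 2 < v < n -> m1 v = st LABEL v].
have labE v : m (base + (width * v + LABEL)) = st LABEL v.
  by rewrite mg glue_offset.
have m0 : m 0 = n by rewrite mg /glue ifT // (leq_trans _ B2).
have m2 : m 2 = base by rewrite mg /glue B2.
have dis v : (base + (width * v + LABEL) == base + (width * 0 + T_)) = false.
  by apply/eqP; rewrite /width; lia.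
have low x y : x < base -> (x == base + y) = false by move=> xb; apply/eqP; lia.
have labelE m' e : m' 2 = base ->
    (forall v, m' (base + (width * v + LABEL)) = st LABEL v) ->
    eval m' (output_label e) = st LABEL (eval m' e).
  move=> m'2 m'L; rewrite -m'L -(offsetE _ _ m'2) //.
have counterE m' : m' 2 = base ->
    eval m' (cexp (hvar T_)) = m' (base + (width * 0 + T_)).
  by move=> m'2; rewrite -[RHS]/(m' (base + (width * eval m' (Const 0) + T_))) -(offsetE _ _ m'2).
apply/runs_seq/runs_store; rewrite (offsetE _ _ m2).
have -> : eval m (Defs.Sub (Read (Const 0)) (Const 3)) = n - 3 by rewrite /= m0.
apply/runs_seq; apply: (runs_weaken (Q := Inv 0)); last first.
  apply: (runs_while (Inv := Inv) (leq_subr 3 n)).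
  - split; rewrite /update ?eqxx //.
    + by rewrite low // ltnW // ltnW.
    + by rewrite low.
    + by split=> v; [rewrite dis | case/andP; lia].
  - by move=> j m1 _ [_ _ m12 m1T _]; rewrite counterE.
  - move=> j m1 jr [_ m10 m12 m1T [m1L m1v]]; apply/runs_seq/runs_store.
    have aE : eval m1 (Add (cexp (hvar T_)) (Const 2)) = j + 3.
      by rewrite -[LHS]/(eval m1 (cexp (hvar T_)) + 2) counterE // m1T; lia.
    rewrite labelE // aE; set m3 := update m1 _ _.
    have j3 : j + 3 < n by lia.
    have m3hi y : m3 (base + y) = m1 (base + y).
      by rewrite /m3 /update eq_sym low // (ltn_trans j3).
    have m32 : m3 2 = base by rewrite /m3 /update m12 ifF //; apply/eqP; lia.
    apply/runs_store; rewrite (offsetE _ _ m32).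
    have -> : eval m3 (Defs.Sub (cexp (hvar T_)) (Const 1)) = j.
      by rewrite -[LHS]/(eval m3 (cexp (hvar T_)) - 1) counterE // m3hi m1T; lia.
    split; rewrite /update ?eqxx //.
    + exact: ltnW.
    + by rewrite low ?(ltnW (ltnW B2)) // /m3 /update ifF //; apply/eqP; lia.
    + by rewrite low.
    + split=> v; first by rewrite dis m3hi.
      case/andP=> jv vn; rewrite low ?(ltn_trans vn) // /m3 /update.
      by case: eqP => [->//|ne]; apply: m1v; lia.
move=> m1 [_ _ m12 _ [m1L m1v]].
have hi m' x z : x < base -> (forall v, m' (base + (width * v + LABEL)) = st LABEL v) ->
    forall v, update m' x z (base + (width * v + LABEL)) = st LABEL v.
  by move=> xb m'L v; rewrite /update eq_sym low.
have b0 : 0 < base by apply: ltn_trans B2.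
have b1 : 1 < base by apply: ltn_trans B2.
apply/runs_seq/runs_store; rewrite labelE //.
apply/runs_seq/runs_store; rewrite labelE //; last exact: hi.
apply/runs_store; rewrite labelE //; last exact: hi b1 (hi _ _ _ b0 m1L).
case=> [|[|[|v]]] vn; rewrite /update //=; exact: m1v.
Qed.

End Program.

(** * From labels to a partition *)

Section Partition.
Variables (V : finType) (G : sgraph V) (k : nat) (F : V -> nat).
Hypothesis Fk : forall v, F v < k.
Hypothesis cds : forall i, i < k -> connected_dominating G [set v | F v == i].

(** Dominating sets are nonempty by definition, so the [k] classes are pairwise distinct and none of
    them is empty. *)
Lemma cds_partition_of_labels :
  cds_partition G k [set [set v | F v == i] | i : 'I_k].
Proof.
split.
- apply/and3P; split.
  + apply/eqP/setP=> v; rewrite inE; apply/bigcupP.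
    exists [set u | F u == Ordinal (Fk v)]; last by rewrite inE.
    exact: imset_f.
  + apply/trivIsetP=> _ _ /imsetP[i _ ->] /imsetP[j _ ->] ij.
    rewrite -setI_eq0; apply/eqP/setP=> v; rewrite !inE; apply/negP.
    by case/andP=> /eqP vi /eqP vj; case/eqP: ij; rewrite -vi -vj.
  + by apply/imsetP=> -[i _ /esym/eqP]; case: (cds (ltn_ord i)) => /negPf->.
- rewrite card_imset ?card_ord // => i j ij.
  have [/set0Pn[v vi] _ _] := cds (ltn_ord i).
  have := vi; rewrite ij !inE => /eqP vj; move: vi; rewrite inE vj => /eqP ji.
  exact/val_inj.
- by move=> _ /imsetP[i _ ->]; apply: cds.
Qed.

End Partition.

(** * Transport between an arbitrary vertex set and ordinals *)

Lemma connect_morph (T T' : finType) (e : rel T) (e' : rel T') (f : T -> T') x y :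
  (forall x y, e x y -> e' (f x) (f y)) -> connect e x y -> connect e' (f x) (f y).
Proof.
move=> fe /connectP[p ep ->]; elim: p x ep => [|z p IHp] x /=; first by rewrite connect0.
by case/andP=> /fe/connect1 xz /IHp; apply: connect_trans.
Qed.

Section Transport.
Variables (V : finType) (G : sgraph V).
Notation n := #|V|.

Definition ord_adj : rel 'I_n := [rel i j | G (enum_val i) (enum_val j)].

Lemma ord_adj_sym : symmetric ord_adj.
Proof. by move=> i j; apply: adj_sym. Qed.

Lemma ord_adj_irrefl : irreflexive ord_adj.
Proof. by move=> i; apply: adj_irrefl. Qed.

Definition ord_graph := SGraph ord_adj_sym ord_adj_irrefl.

Lemma ord_graphE x y : ord_graph (enum_rank x) (enum_rank y) = G x y.
Proof. by rewrite -[LHS]/(G _ _) !enum_rankK. Qed.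

Lemma ord_k_connected k : k_connected G k -> k_connected ord_graph k.
Proof.
move=> [kV kc]; split; first by rewrite card_ord.
move=> X Xk i j iX jX.
have valX l : (enum_val l \in [set enum_val u | u in X]) = (l \in X).
  by rewrite mem_imset //; apply: enum_val_inj.
have := kc [set enum_val l | l in X] (leq_ltn_trans (leq_imset_card _ _) Xk)
  (enum_val i) (enum_val j).
rewrite !in_setC !valX -!in_setC => /(_ iX jX) c.
rewrite -(enum_valK i) -(enum_valK j); apply: connect_morph c => x y.
rewrite /induced_adj /= !in_setC => /and3P[xX yX xy].
have mem z : z \notin [set enum_val l | l in X] -> enum_rank z \notin X.
  by rewrite -valX enum_rankK.
by apply/and3P; split; [exact: mem | exact: mem | move: xy; rewrite -ord_graphE].
Qed.

Lemma ord_interval_graph (R : realType) : interval_graph G R -> interval_graph ord_graph R.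
Proof.
move=> [I [Ine IG]]; exists (fun i => I (enum_val i)); split=> [i|i j ij]; first exact: Ine.
by apply: IG; rewrite (inj_eq enum_val_inj).
Qed.

Lemma cds_of_ord (S : {set 'I_n}) :
  connected_dominating ord_graph S ->
  connected_dominating G [set v | enum_rank v \in S].
Proof.
case=> /set0Pn[i iS] conn dom; split.
- by apply/set0Pn; exists (enum_val i); rewrite inE enum_valK.
- move=> x y; rewrite !inE => xS yS.
  rewrite -(enum_rankK x) -(enum_rankK y); apply: connect_morph (conn _ _ xS yS) => u v.
  by rewrite /induced_adj /= !inE !enum_valK.
- move=> v; rewrite inE => /dom[u uS vu]; exists (enum_val u).
    by rewrite inE enum_valK.
  by rewrite -ord_graphE enum_valK.
Qed.

End Transport.

Lemma based_inputP n k (G : sgraph 'I_n) p : 0 < p < n * n ->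
  based_input k G (p + 2) = [exists i : 'I_n, exists j : 'I_n, (p == n * i + j) && G i j].
Proof. by case: p => // p _; rewrite addn2. Qed.

Lemma k_connected_gt1 (V : finType) (G : sgraph V) k :
  0 < k -> k_connected G k -> 1 < #|V|.
Proof. by move=> k0 [kV _]; apply: leq_trans kV. Qed.

Theorem theorem7 :
  (forall (R : realType) (k : nat) (V : finType) (G : sgraph V),
     1 <= k -> k_connected G k -> interval_graph G R ->
     exists P : {set {set V}}, cds_partition G k P) /\
  (exists (prog : cmd) (c d : nat),
     forall (R : realType) (k n : nat) (G : sgraph 'I_n),
       1 <= k -> k_connected G k -> interval_graph G R ->
       exists (t : nat) (m : memory),
         [/\ exec prog (encode G k) t m,
             t <= c * n ^ d
           & cds_partition G k (decode n k m)]).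
Proof.
split=> [R k V G k0 conn itv|].
  have V1 := k_connected_gt1 k0 conn.
  have conn' := ord_k_connected conn.
  have [|a /andP[sa ua]] := interval_graph_leftmost _ (ord_interval_graph itv).
    by rewrite card_ord ltnW.
  (* Existence, too, comes from the algorithm: its abstract semantics is evaluated on the copy of
     [G] on ordinals. *)
  have := algorithm_correct (leqnn _) (@based_inputP _ k _) k0 conn' sa ua (st := fun _ _ => 0).
  set st := run _ _ _ _ _ _ => -[//|Fk cds].
  exists [set [set v | st LABEL (enum_rank v) == i] | i : 'I_k].
  apply: cds_partition_of_labels => // i ik.
  have := cds_of_ord (cds i ik); congr (connected_dominating G _).
  by apply/setP=> v; rewrite !inE.
(* The constants depend on the program alone, hence are uniform in [k] and [G]. *)
have [c [d cd]] := time_bound_poly cds_program; exists cds_program, c, d.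
move=> R k n G k0 conn itv.
have n1 : 1 < n by rewrite -(card_ord n); apply: k_connected_gt1 conn.
have kn : k <= n by case: conn; rewrite card_ord => /ltnW.
have [|a /andP[sa ua]] := interval_graph_leftmost _ itv; first by rewrite card_ord ltnW.
have [//|Fk cds] := algorithm_correct (leqnn _) (@based_inputP _ k _)
  k0 conn sa ua (st := fun _ _ => 0).
set st := run _ _ _ _ _ _ in Fk cds.
suff [t [m [ex tb mE]]] :
    runs n cds_program (encode G k) (fun m => forall v, v < n -> m v = st LABEL v).
  exists t, m; split=> //; first by apply: leq_trans tb (cd n (ltnW n1)).
  have -> : decode n k m = [set [set v : 'I_n | st LABEL v == i] | i : 'I_k].
    by apply: eq_imset => i; apply/setP=> v; rewrite !inE mE.
  exact: cds_partition_of_labels.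
have B2 : 2 < n * n + 2 by nia.
have kE : based_input k G 1 = k by [].
(* The phases are chained through memories of the form [glue], beginning with the all-zero state. *)
apply/runs_seq/(runs_weaken _ (set_base_correct k G n1)) => m1 m1E; apply/runs_seq.
apply: (runs_weaken _ (compile_correct B2 _ _ kn kE algorithm_wf m1E)) => // m2 m2E.
exact: output_correct m2E.
Qed.
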